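(* Let $\rho_x\in H^2(0,1)$ satisfy $0<m\le|\rho_x|\le M$ almost everywhere, and let $\theta\in L^2(0,1)$. If there exists $T>0$ such that $\operatorname{supp}(\mathcal F(\theta))\subset[-T,T]$, where $\mathcal F$ denotes the Fourier transform operator, then there exist constants $\tilde C_1,\tilde C_2>0$ and hyperparameters $\kappa_0,\lambda_0$, depending only on $T$ in the case of $\kappa_0,\lambda_0$, such that for all $\kappa\in(m^2,\kappa_0)$ and $\lambda\le\lambda_0$, $$\tilde C_1\|\theta\|_{H^{-1}}^2\le\lim_{\varepsilon\to 0}\langle\theta,(I-B^{-1})\theta\rangle\le\tilde C_2\|\theta\|_{H^{-1}}^2 .$$
   Context: Parameters satisfy $\kappa,\varepsilon>0$, $\lambda\ge 0$. $\rho$ is a real function on $(0,1)$ with derivative $\rho_x$. $B^{-1}$ is the operator on $L^2(0,1)$ $$B^{-1}=M_{\rho_x}L_\rho^{-1}M_{\rho_x},\qquad L_\rho=\varepsilon\Delta^2-\lambda\Delta+(\kappa+\rho_x^2)I,$$ where $M_f(g)=fg$ is multiplication by $f$, $\Delta=d^2/dx^2$, and $L_\rho$ is taken with boundary conditions $u=0$, $u_{xx}=0$ at $x\in\{0,1\}$ (so $B^{-1}$ depends on $\kappa,\lambda,\varepsilon$). The operator $I-B^{-1}$ is the Hessian operator of the squared HV metric $\rho_0\mapsto d^2_{\mathrm{HV}}(\rho_0,\rho)$ at $\rho_0=\rho$. $\langle\cdot,\cdot\rangle$ is the $L^2(0,1)$ inner product. $\|w\|_{H^{-1}}=\|(1+|\cdot|^2)^{-1/2}\mathcal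 F(w)\|_{L^2}$. *)

(* Defs.v *)
From mathcomp Require Import all_boot all_order all_algebra.
From mathcomp Require Import all_classical all_reals all_analysis.
From mathcomp Require Import complex.
Set Implicit Arguments.
Unset Strict Implicit.
Unset Printing Implicit Defensive.
Import Order.TTheory GRing.Theory Num.Theory.
Import numFieldNormedType.Exports.
Import ComplexField.Normc.
Local Open Scope classical_set_scope.
Local Open Scope ring_scope.

(* Elements of L^2(0,1) are represented by everywhere-defined functions R -> R;
   only their values on ]0,1[, up to null sets, are relevant. *)
Definition mu01 (R : realType) : {measure set (measurableTypeR R) -> \bar R} :=
  mrestr lebesgue_measure
    (measurable_itv `]0, 1[ : measurable (`]0, 1[ : set (measurableTypeR R))).
Arguments mu01 {R}.

Definition L2 {R : realType} : {pred R -> R} := Lfun (@mu01 R) 2%:E.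

Definition inner {R : realType} (f g : R -> R) : R := \int[mu01]_x (f x * g x).

Definition C1c {R : realType} (phi : R -> R) : Prop :=
  [/\ forall x, derivable phi x 1,
      continuous (derive1 phi) &
      exists a b : R, [/\ 0 < a, b < 1 &
        forall x, x \notin `[a, b] -> phi x = 0]].

(* C^1 test functions define the same weak derivative as C^oo ones, by
   mollification. *)
Definition is_wderiv {R : realType} (f g : R -> R) : Prop :=
  g \in L2 /\ forall phi, C1c phi -> inner f (derive1 phi) = - inner g phi.

Fixpoint Hsob {R : realType} (k : nat) (f : R -> R) : Prop :=
  f \in L2 /\ (if k is k'.+1 then exists g, is_wderiv f g /\ Hsob k' g else True).

(* The weak derivative is unique up to a null set, so the representative
   selected by [xget] is immaterial. *)
Definition wderiv {R : realType} (f : R -> R) : R -> R :=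
  xget (cst 0) [set g | is_wderiv f g].

Definition laplacian {R : realType} (u : R -> R) : R -> R := wderiv (wderiv u).

(* f is only defined almost everywhere: its boundary values are those of its
   continuous representative on [0,1]. *)
Definition zero_at_bnd {R : realType} (f : R -> R) : Prop :=
  exists g : R -> R, [/\ {within `[0, 1], continuous g},
    f = g %[ae mu01], g 0 = 0 & g 1 = 0].

Definition dom_L {R : realType} (u : R -> R) : Prop :=
  [/\ Hsob 4 u, zero_at_bnd u & zero_at_bnd (laplacian u)].

Definition L_op {R : realType} (eps lam kap : R) (rho_x u : R -> R) : R -> R :=
  fun x => eps * laplacian (laplacian u) x - lam * laplacian u x
           + (kap + rho_x x ^+ 2) * u x.

(* L_op is a bijection from dom_L onto L^2(0,1), modulo null sets, for
   eps, kap > 0, lam >= 0 and bounded rho_x. *)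
Definition L_inv {R : realType} (eps lam kap : R) (rho_x f : R -> R) : R -> R :=
  xget (cst 0) [set u | dom_L u /\ L_op eps lam kap rho_x u = f %[ae mu01]].

Definition B_inv {R : realType} (eps lam kap : R) (rho_x th : R -> R) : R -> R :=
  rho_x \* L_inv eps lam kap rho_x (rho_x \* th).

(* Fourier transform of w extended by zero outside ]0,1[; its value at an
   integer n is also the n-th Fourier coefficient of w. *)
Definition fourier {R : realType} (w : R -> R) (xi : R) : R[i] :=
  Complex (\int[mu01]_x (w x * cos (2 * pi * x * xi)))
          (- \int[mu01]_x (w x * sin (2 * pi * x * xi))).

(* The two Fourier transforms on L^2(0,1): either (0,1) sits in the real line
   and the frequencies are the reals with Lebesgue measure, or it is a period
   and the frequencies are the integers with counting measure. *)
Variant fourier_setting := RealLine | Periodic.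

Definition freq {R : realType} (F : fourier_setting) : set R :=
  if F is RealLine then setT else range (intr : int -> R).

Lemma measurable_range_intr (R : realType) :
  measurable (range (intr : int -> R) : set (measurableTypeR R)).
Proof.
apply: countable_measurable; first by move=> x; exact: measurable_set1.
apply: card_le_trans (card_image_le _ _) _; exact: countableP.
Qed.

Definition freq_measure {R : realType} (F : fourier_setting) :
    {measure set (measurableTypeR R) -> \bar R} :=
  if F is RealLine then lebesgue_measure
  else mrestr counting (@measurable_range_intr R).

Definition supp_fourier {R : realType} (F : fourier_setting) (w : R -> R) : set R :=
  closure [set xi | freq F xi /\ fourier w xi != 0].

Definition Hm1_norm {R : realType} (F : fourier_setting) (w : R -> R) : R :=
  fine (Lnorm (@freq_measure R F) 2%:E (fun xi : R =>
    ((1 + `|xi| ^+ 2) `^ (- 2^-1) * normc (fourier w xi))%:E)).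

(* Main.v *)
Require Import Defs.
From mathcomp Require Import all_boot all_order all_algebra.
From mathcomp Require Import all_classical all_reals all_analysis.
From mathcomp Require Import measurable_realfun complex ring lra zify.
Set Implicit Arguments.
Unset Strict Implicit.
Unset Printing Implicit Defensive.
Import Order.TTheory GRing.Theory Num.Theory.
Import numFieldNormedType.Exports.
Import ComplexField.Normc.
Local Open Scope classical_set_scope.
Local Open Scope ring_scope.

(** Write [c = kap + rho_x ^+ 2] and let G be the Green operator of [- laplacian]
with zero boundary values ([green]).  The domain of L consists of the functions
[u = G (G w)], for which [laplacian u = - G w] and [laplacian (laplacian u) = w],
so that in the unknown [v = G w] the equation [L u = f] reads, tested against [G g],

  [<f, G g> = eps <v, g> + lam <G v, g> + <c * G v, G g>]   for all g in L^2.

The right-hand side is a symmetric form, bounded below by [eps <v, v>] and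
nondecreasing in eps.  With [f = rho_x * theta] one gets
[<theta, B^-1 theta> = <f, u> = <f, G v>], the maximum over g of
[2 <f, G g> - form eps g g].  Two consequences:

- [<f, G v>] decreases with eps, so that the quotient
  [<theta, (I - B^-1) theta>] is monotone in eps and has a limit at 0;
- dropping the two nonnegative terms in eps and lam and maximizing pointwise gives
  [0 <= <f, G v> <= <rho_x ^+ 2 / c * theta, theta> <= s <theta, theta>] with
  [s = M ^+ 2 / (m ^+ 2 + M ^+ 2) < 1], because [kap > m ^+ 2].

Hence [(1 - s) <theta, theta> <= lim <= <theta, theta>] ([hessian_limit]), and the
L^2 norm is left to be compared with the H^-1 norm of theta ([Hm1_equiv]).  If the
frequencies are the integers, theta is a trigonometric polynomial of degree at most
T, and Parseval's identity makes the two norms comparable up to the largest weight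
[1 + T ^+ 2].  If they are the real numbers, theta has both a compact support and a
band-limited transform, so it vanishes and both norms are 0.

Both Fourier facts come from one completeness argument ([fourier_ortho_complete]).
Let E be the set of frequencies at which the coefficients of theta vanish, and call
phi admissible if the coefficients of [theta * phi] vanish on E as well.  Admissible
functions are stable under multiplication by cos and sin of [2 pi x] when E is the
set of integers, and by x when E is a half-line, since multiplication by x is
differentiation in the frequency.  For every interval one of the polynomials t in
these functions is smaller than 1/2 inside and larger than 1/2 outside; then
[(1 - t ^ n) ^ (2 ^ n)] is admissible and converges boundedly to the indicator
function of the interval.  So the integrals of [theta * cos] and [theta * sin] over
every interval vanish.

Weak derivatives are handled through the primitive [prim h x], the integral of h
over (0, x): by the du Bois-Reymond lemma ([is_wderiv_primE]) a function with weak
derivative g is a constant plus [prim g], which turns boundary value problems into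
identities about iterated primitives. *)

(** * Square integrable functions on the unit interval *)

Section Base.
Context {R : realType}.
Implicit Types (f g h : R -> R) (k K x : R).
Local Notation leb := (@lebesgue_measure R).
Local Notation mu := (@mu01 R).

Definition integrable01 f := mu.-integrable setT (EFin \o f).
Definition mblfun f := measurable_fun setT f.

Lemma mbl_cst k : mblfun (fun=> k).
Proof. by rewrite /mblfun; apply: measurable_cst. Qed.

Lemma mbl_norm f : mblfun f -> mblfun (fun x => `|f x|).
Proof. by move=> mf; exact: (measurableT_comp (@normr_measurable _ setT) mf). Qed.

Lemma mblM f g : mblfun f -> mblfun g -> mblfun (fun x => f x * g x).
Proof. by move=> mf mg; apply: measurable_funM. Qed.

Lemma mblD f g : mblfun f -> mblfun g -> mblfun (fun x => f x + g x).
Proof. by move=> mf mg; apply: measurable_funD. Qed.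

Lemma mblB f g : mblfun f -> mblfun g -> mblfun (fun x => f x - g x).
Proof. by move=> mf mg; apply: measurable_funB. Qed.

Lemma mu01E (A : set R) : mu A = leb (A `&` `]0%R, 1%R[).
Proof. by []. Qed.

Lemma mu01_setT : mu setT = 1%E.
Proof.
by rewrite mu01E setTI lebesgue_measure_itv/= lte_fin ltr01 sube0.
Qed.

Lemma ae01 (P : R -> Prop) : (forall x, 0 < x < 1 -> P x) -> {ae mu, forall x, P x}.
Proof.
move=> H; exists (~` `]0,1[); split.
- exact/measurableC.
- by rewrite mu01E setICl measure0.
- by move=> x nP /= /[!in_itv]/= /H.
Qed.

Lemma ae_imp (P Q : R -> Prop) : {ae mu, forall x, P x} -> (forall x, P x -> Q x) ->
  {ae mu, forall x, Q x}.
Proof.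
move=> aP PQ; apply: (@filterS _ _ (ae_filter_ringOfSetsType mu) P) => //.
Qed.

Lemma ae_imp2 (P Q S : R -> Prop) : {ae mu, forall x, P x} -> {ae mu, forall x, Q x} ->
  (forall x, P x -> Q x -> S x) -> {ae mu, forall x, S x}.
Proof.
move=> aP aQ PQS; apply: (@filterS2 _ _ (ae_filter_ringOfSetsType mu) P Q) => //.
Qed.

(** This passes from the measure restricted to ]0, 1[ to Lebesgue integration
over ]0, 1[, where the fundamental theorem of calculus is available. *)
Lemma int01E (f : R -> \bar R) : measurable_fun setT f ->
  (\int[mu]_x f x = \int[leb]_(x in `]0%R, 1%R[) f x)%E.
Proof.
move=> mf.
transitivity (\int[mu]_(x in `]0%R,1%R[) f x)%E.
  rewrite [RHS]integral_mkcond.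
  have mf' : measurable_fun setT (f \_ `]0%R, 1%R[).
    exact: (measurable_restrictT f (measurable_itv `]0%R, 1%R[)).1 (measurable_funTS mf).
  apply: ae_eq_integral; [exact: measurableT|exact: mf|exact: mf'|].
  by apply: ae01 => x x01 _; rewrite patchT// inE/= in_itv/=.
apply: eq_measure_integral => A mA sA.
by rewrite mu01E setIidl.
Qed.

Lemma integrable01_mbl f : integrable01 f -> mblfun f.
Proof. by move=> /(measurable_int mu)/measurable_EFinP. Qed.

Lemma integrable01_bounded f K : mblfun f -> (forall x, 0 < x < 1 -> `|f x| <= K) -> integrable01 f.
Proof.
move=> mf fK; rewrite /integrable01.
have mfe : measurable_fun setT (EFin \o f) by exact/measurable_EFinP.
apply/integrableP; split => //.
apply: (@le_lt_trans _ _ (\int[mu]_x (`|K|%:E))%E).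
  apply: ae_ge0_le_integral => //.
    exact: measurableT_comp.
  by apply: ae01 => x x01 _ /=; rewrite lee_fin (le_trans (fK _ x01)) ?ler_norm.
by rewrite integral_cst// mu01_setT mule1 ltry.
Qed.

Lemma integrable01_le f g : mblfun f -> integrable01 g -> (forall x, `|f x| <= `|g x|) -> integrable01 f.
Proof.
move=> mf ig fg; apply: le_integrable ig => //; first exact/measurable_EFinP.
by move=> x _ /=; rewrite lee_fin.
Qed.

Lemma integrable01_ae f g : mblfun f -> integrable01 g -> f = g %[ae mu] -> integrable01 f.
Proof.
move=> mf ig fg; apply/integrableP; split; first exact/measurable_EFinP.
have mg := integrable01_mbl ig; case/integrableP : ig => _; apply: le_lt_trans.
rewrite le_eqVlt; apply/orP; left; apply/eqP/ae_eq_integral => //.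
- by apply: measurableT_comp => //; exact/measurable_EFinP.
- by apply: measurableT_comp => //; exact/measurable_EFinP.
- by apply: (ae_imp fg) => x /(_ I) /= ->.
Qed.

Lemma integrable01D f g : integrable01 f -> integrable01 g -> integrable01 (fun x => f x + g x).
Proof. by move=> fi gi; exact: (integrableD _ fi gi). Qed.

Lemma integrable01B f g : integrable01 f -> integrable01 g -> integrable01 (fun x => f x - g x).
Proof. by move=> fi gi; exact: (integrableB _ fi gi). Qed.

Lemma integrable01Z k f : integrable01 f -> integrable01 (fun x => k * f x).
Proof. by move=> fi; exact: (integrableZl _ k fi). Qed.

Lemma int_ae f g : mblfun f -> mblfun g -> f = g %[ae mu] ->
  \int[mu]_x f x = \int[mu]_x g x.
Proof.
move=> mf mg fg; congr fine; apply: ae_eq_integral => //.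
- exact/measurable_EFinP.
- exact/measurable_EFinP.
- by apply: (ae_imp fg) => x /(_ I) ->.
Qed.

Lemma int_le_ae f g : integrable01 f -> integrable01 g -> {ae mu, forall x, f x <= g x} ->
  \int[mu]_x f x <= \int[mu]_x g x.
Proof.
move=> fi gi fg; rewrite -subr_ge0 -RintegralB//.
have hi := integrable01B gi fi.
rewrite (@int_ae _ (fun x => `|g x - f x|)).
- exact: Rintegral_ge0.
- exact: integrable01_mbl.
- by apply: measurableT_comp => //; exact: integrable01_mbl.
- by apply: (ae_imp fg) => x fgx _; rewrite ger0_norm// subr_ge0.
Qed.

Lemma int_cst01 (k : R) : \int[mu]_x k = k.
Proof. by rewrite Rintegral_cst// mu01_setT mulr1. Qed.

(** Membership in L^2 is phrased with [integrable01] so that closure properties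
reduce to those of integrable functions. *)
Lemma L2P f : f \in L2 <-> mblfun f /\ integrable01 (fun x => f x ^+ 2).
Proof.
split.
  move=> fL; split; last exact: Lfun2_integrable_sqr.
  by move: fL; rewrite inE => /andP[]; rewrite inE.
move=> [mf] /integrableP[_ fi]; rewrite inE; apply/andP; split; rewrite inE//=.
rewrite /finite_norm unlock poweR_lty//.
apply: le_lt_trans fi; rewrite le_eqVlt; apply/orP; left; apply/eqP.
by apply: eq_integral => x _ /=; rewrite normrX powR_mulrn.
Qed.

Lemma L2_mbl f : f \in L2 -> mblfun f. Proof. by move=> /L2P[]. Qed.

Lemma L2_sqr f : f \in L2 -> integrable01 (fun x => f x ^+ 2). Proof. by move=> /L2P[]. Qed.

Lemma L2_mul f g : f \in L2 -> g \in L2 -> integrable01 (fun x => f x * g x).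
Proof. by move=> fL gL; apply/Lfun1_integrable/Lfun2_mul_Lfun1. Qed.

Lemma L2_bounded f K : mblfun f -> (forall x, 0 < x < 1 -> `|f x| <= K) -> f \in L2.
Proof.
move=> mf fK; apply/L2P; split => //; apply: (@integrable01_bounded _ (K ^+ 2)).
  exact: measurable_funX.
by move=> x x01; rewrite normrX ler_sqr ?nnegrE ?fK// (le_trans _ (fK _ x01)).
Qed.

Lemma L2_cst (k : R) : (fun=> k) \in @L2 R.
Proof. by apply: (@L2_bounded _ `|k|) => //; exact: measurable_cst. Qed.

Lemma L2_int f : f \in L2 -> integrable01 f.
Proof.
move=> fL; rewrite (_ : f = fun x => f x * (cst 1 x)).
  exact: (L2_mul fL (L2_cst 1)).
by apply/funext => x; rewrite /= mulr1.
Qed.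

Lemma L2D f g : f \in L2 -> g \in L2 -> (fun x => f x + g x) \in L2.
Proof.
move=> fL gL; apply/L2P; split; first by apply: measurable_funD; exact: L2_mbl.
rewrite (_ : (fun x => _) = fun x => f x ^+ 2 + (2 * (f x * g x) + g x ^+ 2)).
  by apply: integrable01D (L2_sqr fL) (integrable01D (integrable01Z 2 (L2_mul fL gL)) (L2_sqr gL)).
by apply/funext => x; ring.
Qed.

Lemma L2Z k f : f \in L2 -> (fun x => k * f x) \in L2.
Proof.
move=> fL; apply/L2P; split; first by apply: measurable_funM => //; exact: L2_mbl.
rewrite (_ : (fun x => _) = fun x => k ^+ 2 * f x ^+ 2); first exact: integrable01Z (L2_sqr fL).
by apply/funext => x; rewrite exprMn.
Qed.

Lemma L2N f : f \in L2 -> (fun x => - f x) \in L2.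
Proof.
move=> fL; rewrite (_ : (fun x => _) = fun x => -1 * f x); first exact: L2Z.
by apply/funext => x; rewrite mulN1r.
Qed.

Lemma L2B f g : f \in L2 -> g \in L2 -> (fun x => f x - g x) \in L2.
Proof. by move=> fL /L2N; exact: L2D. Qed.

Lemma L2_ae f g : mblfun f -> g \in L2 -> f = g %[ae mu] -> f \in L2.
Proof.
move=> mf gL fg; apply/L2P; split => //; apply: integrable01_ae (L2_sqr gL) _.
  exact: measurable_funX.
by apply: (ae_imp fg) => x /(_ I) /= ->.
Qed.

Definition ae_bounded (c : R -> R) (K : R) := mblfun c /\ {ae mu, forall x, `|c x| <= K}.

(** The multiplier is bounded only almost everywhere; truncating it where the bound
fails changes nothing up to a null set. *)
Lemma L2M c K f : ae_bounded c K -> f \in L2 -> (fun x => c x * f x) \in L2.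
Proof.
move=> [mc cK] fL.
pose c' x := if `|c x| <= K then c x else 0.
have mc' : mblfun c'.
  apply: measurable_fun_ifT => //.
  by apply: measurable_fun_ler => //; exact: measurableT_comp.
have c'K x : `|c' x| <= `|K|.
  by rewrite /c'; case: ifPn => [/le_trans->//|_]; rewrite ?ler_norm// normr0.
apply: (@L2_ae _ (fun x => c' x * f x)).
- by apply: measurable_funM => //; exact: L2_mbl.
- apply/L2P; split; first by apply: measurable_funM => //; exact: L2_mbl.
  apply: integrable01_le (integrable01Z (K ^+ 2) (L2_sqr fL)) _.
    by apply: measurable_funX; apply: measurable_funM => //; exact: L2_mbl.
  move=> x; rewrite exprMn normrM [leRHS]normrM ler_wpM2r//.
  by rewrite !normrX ler_sqr ?nnegrE// (le_trans (c'K x)) ?ler_norm// ler_norm.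
- by apply: (ae_imp cK) => x cx _; rewrite /c' cx.
Qed.

Lemma innerE f g : inner f g = \int[mu]_x (f x * g x).
Proof. by []. Qed.

Lemma innerC f g : inner f g = inner g f.
Proof. by apply: eq_Rintegral => x _; rewrite mulrC. Qed.

Lemma innerDl f g h : f \in L2 -> g \in L2 -> h \in L2 ->
  inner (fun x => f x + g x) h = inner f h + inner g h.
Proof.
move=> fL gL hL; rewrite /inner -RintegralD//; [|exact: L2_mul..].
by apply: eq_Rintegral => x _; rewrite mulrDl.
Qed.

Lemma innerBl f g h : f \in L2 -> g \in L2 -> h \in L2 ->
  inner (fun x => f x - g x) h = inner f h - inner g h.
Proof.
move=> fL gL hL; rewrite /inner -RintegralB//; [|exact: L2_mul..].
by apply: eq_Rintegral => x _; rewrite mulrBl.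
Qed.

Lemma innerZl k f h : f \in L2 -> h \in L2 ->
  inner (fun x => k * f x) h = k * inner f h.
Proof.
move=> fL hL; rewrite /inner -RintegralZl//; last exact: L2_mul.
by apply: eq_Rintegral => x _; rewrite mulrA.
Qed.

Lemma innerDr f g h : f \in L2 -> g \in L2 -> h \in L2 ->
  inner h (fun x => f x + g x) = inner h f + inner h g.
Proof. by move=> *; rewrite !(innerC h) innerDl. Qed.

Lemma innerBr f g h : f \in L2 -> g \in L2 -> h \in L2 ->
  inner h (fun x => f x - g x) = inner h f - inner h g.
Proof. by move=> *; rewrite !(innerC h) innerBl. Qed.

Lemma innerZr k f h : f \in L2 -> h \in L2 ->
  inner h (fun x => k * f x) = k * inner h f.
Proof. by move=> *; rewrite !(innerC h) innerZl. Qed.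

Lemma inner_ge0 f : 0 <= inner f f.
Proof. by apply: Rintegral_ge0 => x _; rewrite -expr2 sqr_ge0. Qed.

Lemma eq_inner f g f' g' : (forall x, f x * g x = f' x * g' x) ->
  inner f g = inner f' g'.
Proof. by move=> fg; apply: eq_Rintegral => x _. Qed.

Lemma inner_ge0_ptw f g : (forall x, 0 <= f x * g x) -> 0 <= inner f g.
Proof. by move=> fg; apply: Rintegral_ge0 => x _. Qed.

Lemma inner_le_ae f g f' g' : f \in L2 -> g \in L2 -> f' \in L2 -> g' \in L2 ->
  {ae mu, forall x, f x * g x <= f' x * g' x} -> inner f g <= inner f' g'.
Proof. by move=> fL gL f'L g'L; apply: int_le_ae; exact: L2_mul. Qed.

Lemma inner_ae f g h : f \in L2 -> g \in L2 -> h \in L2 -> f = g %[ae mu] ->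
  inner f h = inner g h.
Proof.
move=> fL gL hL fg; apply: int_ae.
- exact: integrable01_mbl (L2_mul fL hL).
- exact: integrable01_mbl (L2_mul gL hL).
- by apply: (ae_imp fg) => x /(_ I) /= ->.
Qed.

Lemma inner_aer f g h : f \in L2 -> g \in L2 -> h \in L2 -> f = g %[ae mu] ->
  inner h f = inner h g.
Proof. by move=> *; rewrite !(innerC h); exact: inner_ae. Qed.

Definition norm2 f := Num.sqrt (inner f f).

Lemma norm2_ge0 f : 0 <= norm2 f. Proof. exact: sqrtr_ge0. Qed.

Lemma norm2_sqr f : norm2 f ^+ 2 = inner f f. Proof. by rewrite sqr_sqrtr// inner_ge0. Qed.

Lemma norm2Z k f : f \in L2 -> norm2 (fun x => k * f x) = `|k| * norm2 f.
Proof.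
move=> fL; rewrite /norm2 innerZl ?innerZr//; last exact: L2Z.
by rewrite mulrA -expr2 sqrtrM ?sqr_ge0// sqrtr_sqr.
Qed.

(** The quadratic form [|a f - b g|^2] is nonnegative; it is evaluated at
[a = <g, g>], [b = <f, g>] when g is not null. *)
Lemma cauchy_schwarz f g : f \in L2 -> g \in L2 -> `|inner f g| <= norm2 f * norm2 g.
Proof.
move=> fL gL.
rewrite -ler_sqr ?nnegrE ?mulr_ge0 ?norm2_ge0// exprMn !norm2_sqr real_normK ?num_real//.
have Q (a b : R) : 0 <= a ^+ 2 * inner f f - 2 * (a * b * inner f g) + b ^+ 2 * inner g g.
  have := inner_ge0 (fun x => a * f x - b * g x).
  rewrite innerBl ?innerBr ?innerZl ?innerZr//; do ?[exact: L2Z|apply: L2B|exact: L2Z].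
  rewrite (innerC g f); congr (_ <= _); ring.
have [g0|gn0] := eqVneq (inner g g) 0.
  have [->|fg0] := eqVneq (inner f g) 0; first by rewrite expr0n/= g0 mulr0.
  have := Q 1 ((inner f f + 1) / inner f g); rewrite g0 mulr0 addr0 mul1r divfK//.
  by have := inner_ge0 f; lra.
have gp : 0 < inner g g by rewrite lt_neqAle eq_sym gn0 inner_ge0.
have := Q (inner g g) (inner f g).
rewrite (_ : _ + _ = inner g g * (inner f f * inner g g - inner f g ^+ 2)); last by ring.
by rewrite pmulr_rge0// subr_ge0.
Qed.

Lemma norm2D f g : f \in L2 -> g \in L2 -> norm2 (fun x => f x + g x) <= norm2 f + norm2 g.
Proof.
move=> fL gL; rewrite -ler_sqr ?nnegrE ?addr_ge0 ?norm2_ge0// norm2_sqr.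
rewrite innerDl ?innerDr//; last exact: L2D.
have := cauchy_schwarz fL gL; rewrite ler_norml => /andP[_ c].
by rewrite sqrrD !norm2_sqr (innerC g f); lra.
Qed.

Lemma norm2_bounded f K : mblfun f -> 0 <= K -> (forall x, 0 < x < 1 -> `|f x| <= K) -> norm2 f <= K.
Proof.
move=> mf K0 fK; rewrite -ler_sqr ?nnegrE ?norm2_ge0// norm2_sqr -[leRHS]int_cst01.
have fL := L2_bounded mf fK.
apply: int_le_ae; [exact: L2_mul|exact: L2_int (L2_cst _)|].
apply: ae01 => x x01; rewrite -expr2 -[leLHS]real_normK ?num_real// ler_sqr ?nnegrE//.
exact: fK.
Qed.

Lemma norm2M c K f : 0 <= K -> ae_bounded c K -> f \in L2 -> norm2 (fun x => c x * f x) <= K * norm2 f.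
Proof.
move=> K0 [mc cK] fL; rewrite -ler_sqr ?nnegrE ?mulr_ge0 ?norm2_ge0// exprMn !norm2_sqr.
have cfL : (fun x => c x * f x) \in L2 by apply: (@L2M _ K).
rewrite -RintegralZl//; last exact: L2_mul.
apply: int_le_ae; [exact: L2_mul|exact: integrable01Z (L2_mul fL fL)|].
apply: (ae_imp cK) => x cx; rewrite -!expr2 exprMn ler_wpM2r ?sqr_ge0//.
by rewrite -[leLHS]real_normK ?num_real// ler_sqr ?nnegrE.
Qed.

(** Dominated convergence with the dominating function [K * |f|]. *)
Lemma bounded_cvg f (p : nat -> R -> R) (q : R -> R) K : integrable01 f ->
  (forall n, mblfun (p n)) -> mblfun q -> (forall n x, 0 < x < 1 -> `|p n x| <= K) ->
  {ae mu, forall x, p ^~ x @ \oo --> q x} ->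
  inner f (p n) @[n --> \oo] --> inner f q.
Proof.
move=> fi mp mq pK pq.
have mf := integrable01_mbl fi.
have [|||||qi _ c] := @dominated_convergence _ _ _ mu _ measurableT
  (fun n x => (f x * p n x)%:E) (fun x => (f x * q x)%:E)
  (fun x => (`|K| * `|f x|)%:E).
- by move=> n; apply/measurable_EFinP; exact: (mblM mf (mp n)).
- by apply/measurable_EFinP; exact: (mblM mf mq).
- apply: (ae_imp pq) => x pqx _; apply: cvg_EFin; first exact: nearW.
  by apply: cvgM => //; exact: cvg_cst.
- apply: integrable01Z; apply: integrable01_le fi _ => //; first exact: measurableT_comp.
  by move=> x; rewrite normr_id.
- apply: ae01 => x x01 n _; rewrite lee_fin normrM mulrC ler_wpM2r//.
  by rewrite (le_trans (pK _ _ x01)) ?ler_norm.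
apply: (@fine_cvg _ _ _ _ (fun n => (\int[mu]_x (f x * p n x)%:E)%E)).
rewrite fineK; first exact: c.
exact: (@integrable_fin_num _ _ _ mu setT measurableT _ qi).
Qed.

End Base.

(** * Primitives *)

Section Prim.
Context {R : realType}.
Implicit Types (f g h : R -> R) (k K x y : R).
Local Notation leb := (@lebesgue_measure R).
Local Notation mu := (@mu01 R).

Definition ind_le x : R -> R := fun t => (t <= x)%R%:R.
(** The integral of h over (0, x), written as an inner product so that
linearity and the Cauchy-Schwarz inequality apply directly. *)
Definition prim h x := inner h (ind_le x).

Lemma mbl_indicator (b : R -> bool) : measurable_fun setT b -> mblfun (fun x => (b x)%:R : R).
Proof.
move=> mb; rewrite (_ : (fun x => _) = fun x => if b x then 1 else 0).
  exact: (measurable_fun_ifT mb (mbl_cst 1) (mbl_cst 0)).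
by apply/funext => x; case: (b x).
Qed.

Lemma ind_le_L2 x : ind_le x \in L2.
Proof.
apply: (@L2_bounded _ _ 1); last by move=> t _; rewrite /ind_le; case: (t <= x)%R; rewrite ?normr1 ?normr0.
by apply: mbl_indicator; apply: measurable_fun_ler => //; exact: measurable_id.
Qed.
Hint Resolve ind_le_L2 : core.

Lemma mu01_set1 x : mu [set x] = 0%E.
Proof.
rewrite mu01E; apply/eqP; rewrite -measure_le0 -(lebesgue_measure_set1 x).
apply: le_measure; rewrite ?inE; [|exact: measurable_set1|exact: subIsetl].
by apply: measurableI; [exact: measurable_set1|exact: measurable_itv].
Qed.

Lemma ae_neq x : {ae mu, forall t, t != x}.
Proof.
exists [set x]; split; [exact: measurable_set1|exact: mu01_set1|].
by move=> t /= /negP; rewrite negbK => /eqP.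
Qed.

Lemma primD f g : f \in L2 -> g \in L2 ->
  prim (fun x => f x + g x) = fun x => prim f x + prim g x.
Proof. by move=> fL gL; apply/funext => x; rewrite /prim innerDl. Qed.

Lemma primB f g : f \in L2 -> g \in L2 ->
  prim (fun x => f x - g x) = fun x => prim f x - prim g x.
Proof. by move=> fL gL; apply/funext => x; rewrite /prim innerBl. Qed.

Lemma primZ k f : f \in L2 -> prim (fun x => k * f x) = fun x => k * prim f x.
Proof. by move=> fL; apply/funext => x; rewrite /prim innerZl. Qed.

Lemma prim_ae f g : f \in L2 -> g \in L2 -> f = g %[ae mu] -> prim f = prim g.
Proof. by move=> fL gL fg; apply/funext => x; exact: inner_ae. Qed.

Lemma prim_le0 f x : x <= 0 -> f \in L2 -> prim f x = 0.
Proof.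
move=> x0 fL; rewrite /prim -[RHS](int_cst01 0); apply: int_ae.
- exact: integrable01_mbl (L2_mul fL (ind_le_L2 x)).
- exact: mbl_cst.
- apply: ae01 => t /andP[t0 _] _.
  by rewrite /ind_le leNgt (le_lt_trans x0 t0) mulr0.
Qed.

Lemma prim_ge1 f x : 1 <= x -> f \in L2 -> prim f x = \int[mu]_t f t.
Proof.
move=> x1 fL; apply: int_ae.
- exact: integrable01_mbl (L2_mul fL (ind_le_L2 x)).
- exact: L2_mbl.
- apply: ae01 => t /andP[_ t1] _.
  by rewrite /ind_le (le_trans (ltW t1) x1) mulr1.
Qed.

Lemma prim_bound f x : f \in L2 -> `|prim f x| <= norm2 f.
Proof.
move=> fL; apply: le_trans (cauchy_schwarz fL (ind_le_L2 x)) _.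
rewrite ler_piMr ?norm2_ge0//; apply: norm2_bounded; [exact: L2_mbl|exact: ler01|].
by move=> t _; rewrite /ind_le; case: (t <= x)%R; rewrite ?normr1 ?normr0.
Qed.

(** The difference of the two values is the inner product of f with the indicator
function of an interval of length [|x - y|]. *)
Lemma prim_holder f x y : f \in L2 -> `|prim f x - prim f y| <= norm2 f * Num.sqrt `|x - y|.
Proof.
wlog xy : x y / y <= x => [H fL|fL].
  have [/H|/ltW/H] := leP y x; first exact.
  by rewrite distrC (distrC x); apply.
rewrite /prim -innerBr//.
apply: le_trans (cauchy_schwarz fL _) _; first by apply: L2B.
rewrite ler_wpM2l ?norm2_ge0// ger0_norm ?subr_ge0//.
rewrite ler_sqrt ?subr_ge0// /inner.
have mi : measurable (`]y, x]%classic : set (measurableTypeR R)) by exact: measurable_itv.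
rewrite (_ : (fun t => _) = \1_(`]y,x]%classic : set (measurableTypeR R))); last first.
  apply/funext => t; rewrite indicE /ind_le.
  have -> : (t \in `]y, x]%classic) = (y < t <= x) by apply/idP/idP; rewrite inE/= in_itv.
  case: (leP t x) => tx; case: (leP t y) => ty //=; rewrite ?andbF/=; lra.
rewrite /Rintegral integral_indic// setIT mu01E.
rewrite -lee_fin fineK; last first.
  rewrite ge0_fin_numE ?measure_ge0//.
  rewrite (@le_lt_trans _ _ (leb `]0%R,1%R[))//; last by rewrite lebesgue_measure_itv/= lte_fin ltr01 ltry.
  by apply: le_measure; rewrite ?inE//; exact: measurableI.
rewrite (@le_trans _ _ (leb `]y, x]))//.
  by apply: le_measure; rewrite ?inE//; exact: measurableI.
rewrite lebesgue_measure_itv/= lte_fin; case: ifPn => // _.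
by rewrite lee_fin subr_ge0.
Qed.

Lemma prim_continuous f : f \in L2 -> continuous (prim f).
Proof.
move=> fL x; apply/cvgrPdist_le => /= e e0.
have [N0 Ne] : 0 <= norm2 f /\ 0 < norm2 f + 1 by split; rewrite ?ltr_wpDl ?norm2_ge0.
have d0 : 0 < e / (norm2 f + 1) by rewrite divr_gt0.
near=> y.
rewrite (le_trans (prim_holder x y fL))//.
rewrite (@le_trans _ _ ((norm2 f + 1) * Num.sqrt `|x - y|))//.
  by rewrite ler_wpM2r ?sqrtr_ge0// lerDl.
rewrite mulrC -ler_pdivlMr// (_ : e / _ = Num.sqrt ((e / (norm2 f + 1)) ^+ 2)); last by rewrite sqrtr_sqr gtr0_norm.
rewrite ler_sqrt ?sqr_ge0//.
near: y; apply: cvgr_dist_le; [exact: cvg_id|by rewrite exprn_gt0].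
Unshelve. all: by end_near. Qed.

Lemma prim_mbl f : f \in L2 -> mblfun (prim f).
Proof. by move=> fL; apply: continuous_measurable_fun; exact: prim_continuous. Qed.

Lemma prim_L2 f : f \in L2 -> prim f \in L2.
Proof.
move=> fL; apply: (@L2_bounded _ _ (norm2 f)); first exact: prim_mbl.
by move=> x _; exact: prim_bound.
Qed.

Lemma norm2_prim f : f \in L2 -> norm2 (prim f) <= norm2 f.
Proof.
move=> fL; apply: norm2_bounded; [exact: prim_mbl|exact: norm2_ge0|].
by move=> x _; exact: prim_bound.
Qed.

End Prim.
#[global] Hint Resolve ind_le_L2 : core.

(** * Integration by parts *)

Section IntegrationByParts.
Context {R : realType}.
Implicit Types (f g h : R -> R) (k K x y : R).
Local Notation leb := (@lebesgue_measure R).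
Local Notation mu := (@mu01 R).

Lemma leb01_fin : (leb (`]0%R, 1%R[ : set (measurableTypeR R)) < +oo)%E.
Proof. by rewrite lebesgue_measure_itv/= lte_fin ltr01 sube0 ltry. Qed.

(** [mu01] bundled as a finite measure, as needed for product measures. *)
Definition fmu01 := mfrestr (measurable_itv `]0%R, 1%R[ : measurable (`]0, 1[ : set (measurableTypeR R))) leb01_fin.

Lemma integrable01_abs_fin f : integrable01 f -> (\int[mu]_x `|(f x)%:E|)%E = (\int[mu]_x `|f x|)%:E.
Proof.
move=> fi; have mf := integrable01_mbl fi; rewrite /Rintegral fineK//.
have : integrable01 (fun x => `|f x|).
  apply: integrable01_le fi _; first exact: measurableT_comp.
  by move=> x; rewrite normr_id.
by move=> /(integrable_fin_num measurableT).
Qed.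

(** A bounded kernel is integrable for the product measure against [f(x) g(y)],
so the order of integration may be exchanged. *)
Lemma Fubini_kernel f g (k : R * R -> R) : integrable01 f -> integrable01 g -> measurable_fun setT k ->
  (forall z, `|k z| <= 1) ->
  inner f (fun x => inner g (fun y => k (x, y))) =
  inner g (fun y => inner f (fun x => k (x, y))).
Proof.
move=> fi gi mk k1.
have mf := integrable01_mbl fi; have mg := integrable01_mbl gi.
pose F (z : R * R) := (f z.1 * g z.2 * k z)%:E.
have mF : measurable_fun setT F.
  apply/measurable_EFinP; apply: measurable_funM => //.
  apply: measurable_funM.
    exact: (measurableT_comp mf (@measurable_fst _ _ _ _)).
  exact: (measurableT_comp mg (@measurable_snd _ _ _ _)).
have F1 x y : (`|F (x, y)| <= `|f x|%:E * `|(g y)%:E|)%E.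
  rewrite lee_fin !normrM ler_piMr ?mulr_ge0//.
have iF : (fmu01 \x fmu01)%E.-integrable setT F.
  apply/(integrable12ltyP fmu01 fmu01 mF).
  apply: (@le_lt_trans _ _ (\int[mu]_x (`|(f x)%:E| * (\int[mu]_y `|g y|)%:E)))%E.
    apply: ge0_le_integral => //.
    - by move=> x _; exact: integral_ge0.
    - refine (@measurable_fun_fubini_tonelli_F _ _ _ _ _ fmu01 (abse \o F) _ _).
        by apply: measurableT_comp.
      by move=> z; exact: abse_ge0.
    - have h : mblfun (fun x => `|f x| * \int[mu]_y `|g y|) by apply: mblM (mbl_cst _); exact: mbl_norm.
      exact: ((measurable_EFinP setT _).2 h).
    - move=> x _; rewrite -(integrable01_abs_fin gi) -ge0_integralZl//.
      + apply: ge0_le_integral => //.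
        * apply/measurableT_comp => //.
          exact: (measurableT_comp mF (@measurable_pair1 _ _ _ _ x)).
        * have h : mblfun (fun y => `|f x| * `|g y|) by apply: mblM (mbl_cst _) _; exact: mbl_norm.
          exact: ((measurable_EFinP setT _).2 h).
      + by apply: measurableT_comp => //; exact/measurable_EFinP.
  rewrite ge0_integralZr//.
  - by rewrite (integrable01_abs_fin fi) -EFinM ltry.
  - by apply: measurableT_comp => //; exact/measurable_EFinP.
  - by rewrite lee_fin; apply: Rintegral_ge0.
have E := Fubini iF.
have mk1 x : mblfun (fun y => k (x, y)) by exact: (measurableT_comp mk (@measurable_pair1 _ _ _ _ x)).
have mk2 y : mblfun (fun x => k (x, y)) by exact: (measurableT_comp mk (@measurable_pair2 _ _ _ _ y)).
have H1 x : integrable01 (fun y => g y * k (x, y)).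
  apply: integrable01_le gi _; first exact: mblM.
  by move=> y; rewrite normrM ler_piMr.
have H2 y : integrable01 (fun x => f x * k (x, y)).
  apply: integrable01_le fi _; first exact: mblM.
  by move=> x; rewrite normrM ler_piMr.
rewrite /inner; congr fine.
transitivity (\int[fmu01]_x \int[fmu01]_y F (x, y))%E.
  apply: eq_integral => x _; rewrite -RintegralZl//; last exact: H1.
  rewrite /Rintegral fineK; first by apply: eq_integral => y _; rewrite /F/= mulrA.
  exact: (integrable_fin_num measurableT (integrable01Z (f x) (H1 x))).
transitivity (\int[fmu01]_y \int[fmu01]_x F (x, y))%E; first exact: E.
apply: eq_integral => y _; rewrite -RintegralZl//; last exact: H2.
rewrite /Rintegral fineK; first by apply: eq_integral => x _; rewrite /F/= mulrCA mulrA.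
exact: (integrable_fin_num measurableT (integrable01Z (g y) (H2 y))).
Qed.

Lemma prim1E f : f \in L2 -> prim f 1 = \int[mu]_x f x.
Proof. by move=> fL; rewrite prim_ge1. Qed.

Lemma inner_cst f k : f \in L2 -> inner f (fun=> k) = k * prim f 1.
Proof.
move=> fL; rewrite prim1E// -RintegralZl//; last exact: L2_int.
by apply: eq_Rintegral => x _; rewrite mulrC.
Qed.

(** Exchange the integrals of [f(x) g(y)] over the triangle [x <= y]; this is
[(prim f * prim g)' = f * prim g + prim f * g] integrated, for merely square
integrable f and g. *)
Lemma prim_ibp f g : f \in L2 -> g \in L2 ->
  inner f (prim g) + inner (prim f) g = prim f 1 * prim g 1.
Proof.
move=> fL gL.
(* the indicator function of the triangle *)
pose k (z : R * R) : R := (z.1 <= z.2)%R%:R.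
have k1 z : `|k z| <= 1 by rewrite /k; case: (z.1 <= z.2)%R; rewrite ?normr1 ?normr0.
have mk : measurable_fun setT k.
  rewrite (_ : k = fun z : R * R => if z.1 <= z.2 then 1 else 0); last first.
    by apply/funext => z; rewrite /k; case: (z.1 <= z.2)%R.
  apply: measurable_fun_ifT; [|exact: measurable_cst|exact: measurable_cst].
  apply: measurable_fun_ler; [exact: measurable_fst|exact: measurable_snd].
have kE x : inner g (fun y => k (x, y)) = prim g 1 - prim g x.
  rewrite -[prim g 1]mul1r -inner_cst// /prim -innerBr//; last exact: L2_cst.
  apply: inner_aer => //; last 2 first.
  - by apply: L2B; [exact: L2_cst|].
  - apply: (ae_imp (ae_neq x)) => y yx _; rewrite /k /ind_le /=.
    by move: yx; case: (ltgtP x y) => //= _ _; rewrite ?subr0 ?subrr.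
  apply: (@L2_bounded _ _ 1); last by move=> *; exact: k1.
  exact: (measurableT_comp mk (@measurable_pair1 _ _ _ _ x)).
have := Fubini_kernel (L2_int fL) (L2_int gL) mk k1.
under [X in inner f X]eq_fun do rewrite kE.
rewrite innerBr//; [|exact: L2_cst|exact: prim_L2].
rewrite inner_cst// -[X in _ = X -> _]/(inner g (prim f)) (innerC (prim f)) => <-.
by rewrite addrC subrK mulrC.
Qed.

End IntegrationByParts.

(** * Differentiation of primitives *)

Section Differentiation.
Context {R : realType}.
Implicit Types (f g h : R -> R) (k K x y : R).
Local Notation leb := (@lebesgue_measure R).
Local Notation mu := (@mu01 R).

Lemma integrable_leb_itv h : integrable01 h -> leb.-integrable `]0%R, 1%R[ (EFin \o h).
Proof.
move=> hi; have mh := integrable01_mbl hi; case/integrableP : hi => _ hoo.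
have mhE := (measurable_EFinP setT _).2 mh.
apply/integrableP; split; first exact: measurable_funTS.
by rewrite -int01E//; exact: measurableT_comp.
Qed.

Lemma integrable_leb h : integrable01 h -> leb.-integrable setT (EFin \o (h \_ `]0, 1[)).
Proof.
move=> /integrable_leb_itv; rewrite -restrict_EFin => hi.
exact: ((@integrable_mkcond _ _ _ leb _ (EFin \o h) (measurable_itv `]0%R, 1%R[)).1 hi).
Qed.

Lemma ae_leb (P : R -> Prop) : {ae leb, forall x, P x} -> {ae mu, forall x, P x}.
Proof.
move=> [A [mA A0 sA]]; exists A; split => //.
rewrite mu01E; apply/eqP; rewrite -measure_le0 -A0.
apply: le_measure; rewrite ?inE//.
by apply: measurableI => //; exact: measurable_itv.
Qed.

Lemma prim_itv h x : h \in L2 -> prim h x = \int[leb]_(t in `]-oo, x]) (h \_ `]0, 1[) t.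
Proof.
move=> hL; rewrite /prim /inner /Rintegral int01E; last first.
  exact: ((measurable_EFinP setT _).2 (integrable01_mbl (L2_mul hL (ind_le_L2 x)))).
congr fine; rewrite [LHS]integral_mkcond [RHS]integral_mkcond.
apply: eq_integral => t _; rewrite /patch /ind_le !mem_setE !in_itv/=.
by case: (_ < _ < _); case: (t <= x)%R; rewrite ?mulr1 ?mulr0.
Qed.

(** By the Lebesgue differentiation theorem h is almost everywhere the
derivative of its primitive. *)
Lemma prim0_ae h : h \in L2 -> (forall x, prim h x = 0) -> h = cst 0 %[ae mu].
Proof.
move=> hL h0.
have E : (fun x => \int[leb]_(t in `]-oo, x]) (h \_ `]0, 1[) t) = cst 0.
  by apply/funext => y; rewrite -prim_itv.
have Hi y : leb.-integrable `]-oo, y] (EFin \o (h \_ `]0, 1[)).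
  by apply: integrableS (integrable_leb (L2_int hL)).
have := FTC1Ny Hi (integrable_locally (measurable_itv `]0%R, 1%R[) (integrable_leb_itv (L2_int hL))).
rewrite /= E.
move=> /ae_leb H.
have H1 := @ae01 R (fun x => 0 < x < 1) (fun _ p => p).
apply: (ae_imp2 H H1) => x [_].
by rewrite derive1_cst patchE mem_setE in_itv/= => + x01; rewrite x01 => <-.
Qed.

Lemma prim_ftc h x : h \in L2 -> continuous (h \_ `]0, 1[) ->
  derivable (prim h) x 1 /\ derive1 (prim h) x = (h \_ `]0, 1[) x.
Proof.
move=> hL hc.
have hi := integrable_leb (L2_int hL).
have := @continuous_FTC1 _ (h \_ `]0, 1[) -oo%O x (x + 1).
have E : (fun x => \int[leb]_(t in `]-oo, x]) (h \_ `]0, 1[) t) = prim h.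
  by apply/funext => y; rewrite -prim_itv.
rewrite /= E; apply; [by rewrite ltrDl| |exact: ltNyr|exact: hc].
by apply: integrableS hi.
Qed.
End Differentiation.

(** * Test functions *)

Section TestFunctions.
Context {R : realType}.
Implicit Types (f g h phi psi : R -> R) (k K x y : R).
Local Notation mu := (@mu01 R).

(** Apply the bound at [d = (|c| / (N + 1 + |c|)) ^+ 2]. *)
Lemma sqrt_small_eq0 (N c : R) : 0 <= N ->
  (forall d, 0 < d < 1 -> `|c| <= N * Num.sqrt d) -> c = 0.
Proof.
move=> N0 H; apply/eqP; apply: contraT => c0; exfalso.
have cp : 0 < `|c| by rewrite normr_gt0.
set q := `|c| / (N + 1 + `|c|).
have D0 : 0 < N + 1 + `|c| by lra.
have q0 : 0 < q by rewrite divr_gt0.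
have q1 : q < 1 by rewrite /q ltr_pdivrMr//; lra.
have hq : 0 < q ^+ 2 < 1 by rewrite exprn_gt0//= expr_lt1// ltW.
have := H _ hq; rewrite sqrtr_sqr (gtr0_norm q0).
by rewrite /q mulrCA ler_pMr// ler_pdivlMr//; lra.
Qed.

(** The primitive vanishes at 0 and is Hoelder continuous, so if it is constant
inside the interval this constant is 0; continuity at 1 extends this to 1. *)
Lemma prim_const_eq0 h : h \in L2 ->
  (forall x y, 0 < x < y -> y < 1 -> prim h x = prim h y) -> forall x, prim h x = 0.
Proof.
move=> hL H.
have H0 x : 0 < x < 1 -> prim h x = 0.
  move=> /andP[x0 x1]; apply: (@sqrt_small_eq0 (norm2 h)) => [|d /andP[d0 d1]]; first exact: norm2_ge0.
  have := prim_holder (d * x) 0 hL; rewrite (prim_le0 (lexx 0) hL) !subr0 (H (d * x) x)//; last first.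
    by rewrite mulr_gt0//= gtr_pMl.
  move=> /le_trans; apply; rewrite ler_wpM2l ?norm2_ge0//.
  rewrite (@ger0_norm _ (d * x)) ?mulr_ge0 ?(ltW d0) ?(ltW x0)// ler_sqrt ?(ltW d0)//.
  by rewrite ler_piMr // ltW.
move=> x; have [x0|x0] := leP x 0; first exact: prim_le0.
have [x1|x1] := ltP x 1; first by apply: H0; rewrite x0.
rewrite prim_ge1// -prim1E//.
apply: (@sqrt_small_eq0 (norm2 h)) => [|d /andP[d0 d1]]; first exact: norm2_ge0.
have := prim_holder 1 (1 - d) hL; rewrite (H0 (1 - d)) ?subr0; last lra.
by rewrite (_ : 1 - (1 - d) = d) ?(gtr0_norm d0)//; ring.
Qed.

Definition ind_ioo (a b : R) : R -> R := fun t => (a < t < b)%R%:R.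

Lemma ind_ioo_L2 a b : ind_ioo a b \in L2.
Proof.
apply: (@L2_bounded _ _ 1); last first.
  by move=> t _; rewrite /ind_ioo; case: (a < t < b); rewrite ?normr1 ?normr0.
apply: mbl_indicator; apply: measurable_and; apply: measurable_fun_ltr => //; exact: measurable_id.
Qed.

Lemma inner_ind_ioo h a b : h \in L2 -> a < b -> inner h (ind_ioo a b) = prim h b - prim h a.
Proof.
move=> hL ab; rewrite /prim -innerBr//; apply: inner_aer => //.
- exact: ind_ioo_L2.
- exact: L2B.
- apply: (ae_imp (ae_neq b)) => t tb _; rewrite /ind_ioo /ind_le.
  move: tb; case: (ltgtP t b) => //= tb _; case: (ltgtP t a) => //= ta; rewrite ?subr0 ?subrr//.
  + by have := lt_trans ab tb; rewrite ltNge (ltW ta).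
  + by have := lt_trans ab tb; rewrite ta ltxx.
Qed.

Lemma ind_ioo_eq0_ae h : h \in L2 ->
  (forall a b, 0 < a -> a < b -> b < 1 -> inner h (ind_ioo a b) = 0) -> h = cst 0 %[ae mu].
Proof.
move=> hL H; apply: prim0_ae => //; apply: prim_const_eq0 => // x y /andP[x0 xy] y1.
by apply/eqP; rewrite eq_sym -subr_eq0 -inner_ind_ioo// H.
Qed.

Definition Cc psi := continuous psi /\
  exists a b : R, [/\ 0 < a, b < 1 & forall x, x \notin `[a, b] -> psi x = 0].

Lemma Cc_out psi x : Cc psi -> ~~ (0 < x < 1) -> psi x = 0.
Proof.
move=> [_ [a [b [a0 b1 H]]]] x01; apply: H; apply: contra x01; rewrite in_itv/= => /andP[ax xb].
by rewrite (lt_le_trans a0 ax) (le_lt_trans xb b1).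
Qed.

Lemma Cc_patch psi : Cc psi -> psi \_ `]0, 1[ = psi.
Proof.
move=> Cp; apply/funext => x; rewrite patchE mem_setE in_itv/=.
by case: ifPn => // /(Cc_out Cp) ->.
Qed.

Lemma Cc_bounded psi : Cc psi -> exists K, forall x, `|psi x| <= K.
Proof.
move=> Cp.
have cont : {within `[0, 1], continuous (fun x => `|psi x|)}.
  apply: continuous_subspaceT => x; apply: (@continuous_comp _ _ _ psi (@Num.norm R R)); first exact: Cp.1.
  exact: norm_continuous.
have [c _ H] := EVT_max ler01 cont.
exists `|psi c| => x.
have [x01|x01] := boolP (0 < x < 1); last by rewrite (Cc_out Cp x01) normr0.
by apply: H; rewrite in_itv/= !ltW//; case/andP: x01.
Qed.

Lemma Cc_L2 psi : Cc psi -> psi \in L2.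
Proof.
move=> Cp; have [K HK] := Cc_bounded Cp; apply: (@L2_bounded _ _ K) => //.
by apply: continuous_measurable_fun; exact: Cp.1.
Qed.

Lemma CcB psi phi k : Cc psi -> Cc phi -> Cc (fun x => psi x - k * phi x).
Proof.
move=> [cp [a [b [a0 b1 H]]]] [cq [a' [b' [a'0 b'1 H']]]]; split.
  move=> x; apply: cvgB; first exact: cp.
  by apply: cvgM; [exact: cvg_cst|exact: cq].
exists (Num.min a a'), (Num.max b b'); split.
- by rewrite lt_min a0.
- by rewrite gt_max b1.
- move=> x; rewrite in_itv/= => xo.
  rewrite H ?H' ?mulr0 ?subr0// in_itv/=; apply: contra xo => /andP[ax xb].
    by rewrite ge_min le_max ax xb !orbT.
  by rewrite ge_min le_max ax xb.
Qed.

(** Continuous functions of compact support and mean zero are the derivatives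
of the test functions. *)
Lemma Cc_prim_C1c psi : Cc psi -> prim psi 1 = 0 -> C1c (prim psi) /\ derive1 (prim psi) = psi.
Proof.
move=> Cp p0; have pL := Cc_L2 Cp.
have cp : continuous (psi \_ `]0, 1[) by rewrite (Cc_patch Cp); exact: Cp.1.
have D : derive1 (prim psi) = psi.
  by apply/funext => x; rewrite (prim_ftc x pL cp).2 (Cc_patch Cp).
split=> //; split.
- by move=> x; exact: (prim_ftc x pL cp).1.
- by rewrite D; exact: Cp.1.
- case: Cp => _ [a [b [a0 b1 H]]]; exists a, b; split => // x.
  rewrite in_itv/= negb_and -!ltNge => /orP[xa|bx].
  + rewrite /prim /inner (_ : (fun t => _) = fun=> 0) ?int_cst01//.
    apply/funext => t; rewrite /ind_le; have [tx|tx] := leP t x; last by rewrite mulr0.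
    by rewrite H ?mul0r// in_itv/= negb_and -!ltNge (le_lt_trans tx xa).
  + rewrite -p0 prim1E//; apply: eq_Rintegral => t _; rewrite /ind_le.
    have [tx|tx] := leP t x; first by rewrite mulr1.
    by rewrite mulr0 H// in_itv/= negb_and -!ltNge (lt_trans bx tx) orbT.
Qed.

Lemma C1c_prim phi : C1c phi -> Cc (derive1 phi) /\ phi = prim (derive1 phi).
Proof.
move=> [dp cp [a [b [a0 b1 H]]]].
have C : Cc (derive1 phi).
  split=> //; exists a, b; split => // x.
  rewrite in_itv/= negb_and -!ltNge => xo.
  rewrite derive1E (@near_eq_derive _ _ _ _ (cst 0)) ?derive_cst//.
  case/orP: xo => xo; near=> y; apply: H; rewrite in_itv/= negb_and -!ltNge; apply/orP.
    by left; near: y; exact: lt_nbhsl.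
  by right; near: y; exact: lt_nbhsr.
split=> //; apply/funext => x.
have pL := Cc_L2 C.
have cp' : continuous (derive1 phi \_ `]0, 1[) by rewrite (Cc_patch C).
have := @is_derive_0_is_cst _ (fun x => phi x - prim (derive1 phi) x) x 0.
have phi0 : phi 0 = 0 by apply: H; rewrite in_itv/= negb_and -!ltNge a0.
rewrite phi0 (prim_le0 (lexx 0) pL) subr0 => E; apply/eqP; rewrite -subr_eq0; apply/eqP/E => y.
have [d1 d2] := prim_ftc y pL cp'.
rewrite (_ : 0 = 'D_1 phi y - 'D_1 (prim (derive1 phi)) y).
  by apply: is_deriveB; exact: DeriveDef.
by rewrite -!derive1E d2 (Cc_patch C) subrr.
Unshelve. all: by end_near. Qed.

End TestFunctions.

(** * Weak derivatives *)

Section WeakDerivatives.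
Context {R : realType}.
Implicit Types (f g h phi psi : R -> R) (k K x y : R).
Local Notation leb := (@lebesgue_measure R).
Local Notation mu := (@mu01 R).

Lemma cvgR_unique T (S : set_system T) {FS : ProperFilter S} (u : T -> R) k l :
  u x @[x --> S] --> k -> u x @[x --> S] --> l -> k = l.
Proof.
by move=> uk ul; rewrite -(cvg_lim (@Rhausdorff R) uk) (cvg_lim (@Rhausdorff R) ul).
Qed.

(** The positive part of [(x - a) * (b - x)]. *)
Definition tent (a b : R) : R -> R := fun x => ((x - a) * (b - x) + `|(x - a) * (b - x)|) / 2.

Lemma tent_gt0 a b x : a < x < b -> tent a b x = (x - a) * (b - x).
Proof.
by move=> /andP[ax xb]; rewrite /tent ger0_norm ?mulr_ge0 ?subr_ge0 ?ltW//; field.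
Qed.

Lemma tent_eq0 a b x : a < b -> ~~ (a < x < b) -> tent a b x = 0.
Proof.
move=> ab nx; rewrite /tent ler0_norm ?subrr ?mul0r//.
move: nx; rewrite negb_and -!leNgt => /orP[] h; nra.
Qed.

Lemma tent_ge0 a b x : 0 <= tent a b x.
Proof.
rewrite /tent divr_ge0//.
by have := ler_norm (- ((x - a) * (b - x))); rewrite normrN; lra.
Qed.

Lemma tent_le1 a b x : 0 < a -> a < b -> b < 1 -> tent a b x <= 1.
Proof.
move=> a0 ab b1; have [h|h] := boolP (a < x < b); last by rewrite tent_eq0.
by rewrite tent_gt0//; case/andP: h => *; nra.
Qed.

Lemma tent_continuous a b : continuous (tent a b).
Proof.
move=> x; have c : {for x, continuous (fun x => (x - a) * (b - x))}.
  by apply: cvgM; apply: cvgB; [exact: cvg_id|exact: cvg_cst|exact: cvg_cst|exact: cvg_id].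
by apply: cvgM; [apply: cvgD => //; exact: cvg_norm|exact: cvg_cst].
Qed.

(** These compactly supported functions increase to the indicator function of
]a, b[ as n grows. *)
Definition bump (a b : R) n : R -> R := fun x => 1 - (1 - tent a b x) ^+ n.

Lemma bump_Cc a b n : 0 < a -> a < b -> b < 1 -> Cc (bump a b n).
Proof.
move=> a0 ab b1; split.
  move=> x; apply: cvgB; first exact: cvg_cst.
  apply: (@continuous_comp _ _ _ (fun x => 1 - tent a b x) (fun y : R => y ^+ n)).
    by apply: cvgB; [exact: cvg_cst|exact: tent_continuous].
  exact: exprn_continuous.
exists a, b; split=> // x; rewrite in_itv/= => nx.
rewrite /bump tent_eq0 ?subr0 ?expr1n ?subrr//.
by apply: contra nx => /andP[/ltW-> /ltW->].
Qed.

Lemma bump_cvg a b x : 0 < a -> a < b -> b < 1 -> bump a b n x @[n --> \oo] --> ind_ioo a b x.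
Proof.
move=> a0 ab b1; rewrite /ind_ioo; have [h|h] := boolP (a < x < b); last first.
  rewrite (_ : (fun n => _) = cst 0); first exact: cvg_cst.
  by apply/funext => n; rewrite /bump tent_eq0// subr0 expr1n subrr.
rewrite -[X in _ --> X](subr0 1); apply: cvgB; first exact: cvg_cst.
apply: cvg_expr; rewrite ger0_norm ?subr_ge0 ?tent_le1//.
rewrite tent_gt0//; case/andP: h => *.
by rewrite ltrBlDr ltrDl mulr_gt0// subr_gt0.
Qed.

Lemma bump_norm a b n x : 0 < a -> a < b -> b < 1 -> `|bump a b n x| <= 1.
Proof.
move=> a0 ab b1; have t0 := tent_ge0 a b x; have t1 := tent_le1 x a0 ab b1.
have p0 : 0 <= (1 - tent a b x) ^+ n by rewrite exprn_ge0// subr_ge0.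
have p1 : (1 - tent a b x) ^+ n <= 1 by rewrite exprn_ile1 ?subr_ge0//; lra.
by rewrite /bump ger0_norm; lra.
Qed.

(** Indicator functions of intervals are bounded limits of the functions [bump],
and a function whose integral over every interval vanishes is null. *)
Lemma Cc_ortho_ae h : h \in L2 -> (forall psi, Cc psi -> inner h psi = 0) ->
  h = cst 0 %[ae mu].
Proof.
move=> hL H; apply: ind_ioo_eq0_ae => // a b a0 ab b1.
have c : inner h (bump a b n) @[n --> \oo] --> inner h (ind_ioo a b).
  apply: (@bounded_cvg _ _ _ _ 1); first exact: L2_int.
  - by move=> n; apply: L2_mbl; apply: Cc_L2; exact: bump_Cc.
  - by apply: L2_mbl; exact: ind_ioo_L2.
  - by move=> n x _; exact: bump_norm.
  - by apply: ae01 => x _; exact: bump_cvg.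
apply: (cvgR_unique c).
rewrite (_ : (fun n => _) = cst 0); first exact: cvg_cst.
by apply/funext => n; apply: H; exact: bump_Cc.
Qed.

Lemma ae_cst_eq k : (fun=> k) = cst 0 %[ae mu] -> k = 0.
Proof.
move=> h; rewrite -[LHS](@int_cst01 R) -[RHS](@int_cst01 R).
by apply: int_ae; [exact: mbl_cst|exact: mbl_cst|].
Qed.

(** Subtracting a multiple of one fixed function eta of nonzero mean makes any
test function mean-free, so h minus a suitable constant is orthogonal to all of them. *)
Lemma Cc0_const_ae h : h \in L2 ->
  (forall psi, Cc psi -> prim psi 1 = 0 -> inner h psi = 0) ->
  exists k, h = (fun=> k) %[ae mu].
Proof.
move=> hL H.
have [eta Ceta eta1] : exists2 eta : R -> R, Cc eta & prim eta 1 != 0.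
  apply: contrapT => /forall2NP nE.
  suff : (1 : R) = 0 by move/eqP; rewrite oner_eq0.
  apply: ae_cst_eq; apply: Cc_ortho_ae; first exact: L2_cst.
  move=> psi Cp; have [//|/negP] := nE psi; rewrite negbK => /eqP p0.
  by rewrite innerC inner_cst ?p0 ?mulr0//; exact: Cc_L2.
exists (inner h eta / prim eta 1).
have eL := Cc_L2 Ceta.
have : (fun x => h x - inner h eta / prim eta 1) = cst 0 %[ae mu].
  apply: Cc_ortho_ae; first by apply: L2B => //; exact: L2_cst.
  move=> psi Cp; have pL := Cc_L2 Cp.
  rewrite innerBl//; last exact: L2_cst.
  rewrite [X in _ - X]innerC inner_cst//.
  have := H _ (CcB (prim psi 1 / prim eta 1) Cp Ceta).
  rewrite primB//; last exact: L2Z.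
  rewrite primZ// divfK// subrr => /(_ erefl).
  rewrite innerBr//; last exact: L2Z.
  rewrite innerZr// => /eqP; rewrite subr_eq0 => /eqP ->.
  by ring.
by move=> e; apply: (ae_imp e) => x /(_ I) /eqP; rewrite subr_eq0 => /eqP.
Qed.

Lemma C1c_L2 phi : C1c phi -> phi \in L2.
Proof. by move=> /C1c_prim[C ->]; apply: prim_L2; exact: Cc_L2. Qed.

Lemma C1c_prim1 phi : C1c phi -> prim (derive1 phi) 1 = 0.
Proof.
move=> Cp; have [_ <-] := C1c_prim Cp; case: Cp => _ _ [a [b [_ b1 H]]].
by apply: H; rewrite in_itv/= negb_and -!ltNge b1 orbT.
Qed.

(** If f and g differed at an interior point, they would differ on a
subinterval of positive measure; at the end points one takes limits. *)
Lemma continuous_ae_eq f g : {within `[0, 1], continuous f} -> {within `[0, 1], continuous g} ->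
  f = g %[ae mu] -> forall x, 0 <= x <= 1 -> f x = g x.
Proof.
move=> /continuous_within_itvP -/(_ ltr01)[cf cf0 cf1] /continuous_within_itvP -/(_ ltr01)[cg cg0 cg1] fg.
have H x : 0 < x < 1 -> f x = g x.
  move=> x01; apply/eqP; apply: contraT => nfg; exfalso.
  have xi : x \in `]0, 1[ by rewrite in_itv.
  have c : {for x, continuous (fun x => f x - g x)} by apply: cvgB; [exact: cf|exact: cg].
  have : \forall y \near x, f y - g y != 0.
    by apply: (cvgr_neq0 _ c); rewrite subr_eq0.
  move=> /nbhs_ballP[e /= e0 eb].
  have [A [mA A0 sA]] := fg.
  pose d := Num.min e (1 - x).
  have d0 : 0 < d by rewrite lt_min e0 subr_gt0; case/andP: x01.
  have sub : `]x, (x + d)[%classic `<=` A `&` `]0, 1[.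
    move=> y /=; rewrite !in_itv/= => /andP[xy yd]; case/andP: x01 => x0 x1.
    have [de d1] : d <= e /\ d <= 1 - x by split; rewrite /d ge_min lexx ?orbT.
    split; last by apply/andP; split; lra.
    apply: sA => /(_ I); apply/eqP; rewrite -subr_eq0; apply: eb.
    by rewrite /ball/= distrC ger0_norm; lra.
  have : (leb `]x, (x + d)%R[ <= mu A)%E.
    rewrite mu01E; apply: le_measure; rewrite ?inE//.
    by apply: measurableI => //; exact: measurable_itv.
  rewrite A0 lebesgue_measure_itv/= lte_fin ltrDl d0 -EFinB lee_fin; lra.
move=> x /andP[]; rewrite le_eqVlt => /predU1P[<- _|x0].
  apply: (cvgR_unique cf0); apply: cvg_trans cg0.
  apply: near_eq_cvg; near=> y; apply/esym/H.
  by apply/andP; split; near: y; [exact: nbhs_right_gt|apply: nbhs_right_lt].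
rewrite le_eqVlt => /predU1P[->|x1]; last by apply: H; rewrite x0.
apply: (cvgR_unique cf1); apply: cvg_trans cg1.
apply: near_eq_cvg; near=> y; apply/esym/H.
by apply/andP; split; near: y; [apply: nbhs_left_gt|exact: nbhs_left_lt].
Unshelve. all: by end_near. Qed.

(** Integrating by parts, [prim h] is orthogonal to every mean-free continuous
function of compact support, hence constant, and it vanishes at 0. *)
Lemma C1c_ortho_ae h : h \in L2 -> (forall phi, C1c phi -> inner h phi = 0) ->
  h = cst 0 %[ae mu].
Proof.
move=> hL H; have PL := prim_L2 hL.
have [k Hk] : exists k, prim h = (fun=> k) %[ae mu].
  apply: Cc0_const_ae => // psi Cp p0; have pL := Cc_L2 Cp.
  have := prim_ibp hL pL; rewrite p0 mulr0 H ?add0r//.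
  by have [] := Cc_prim_C1c Cp p0.
have cc : continuous (fun _ : R => k) by move=> ?; exact: cvg_cst.
have E := continuous_ae_eq (continuous_subspaceT (prim_continuous hL))
  (continuous_subspaceT cc) Hk.
have k0 : k = 0 by rewrite -(E 0) ?lexx ?ler01// prim_le0.
apply: prim0_ae => // x; have [x0|x0] := leP x 0; first exact: prim_le0.
have [x1|x1] := leP x 1; first by rewrite E ?x1 ?ltW.
by rewrite prim_ge1 ?(ltW x1)// -prim1E// E// ?lexx ?ler01.
Qed.

(** Integration by parts; the boundary term vanishes as the test function does. *)
Lemma is_wderiv_prim g k : g \in L2 -> is_wderiv (fun x => k + prim g x) g.
Proof.
move=> gL; split=> // phi Cp; have [C E] := C1c_prim Cp; have CL := Cc_L2 C.
rewrite innerDl//; [|exact: L2_cst|exact: prim_L2].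
rewrite [X in X + _]innerC inner_cst// C1c_prim1// mulr0 add0r.
have := prim_ibp gL CL; rewrite C1c_prim1// mulr0 -E => /eqP.
by rewrite addrC addr_eq0 => /eqP.
Qed.

Lemma is_wderiv_unique f g1 g2 : is_wderiv f g1 -> is_wderiv f g2 -> g1 = g2 %[ae mu].
Proof.
move=> [g1L H1] [g2L H2].
have : (fun x => g1 x - g2 x) = cst 0 %[ae mu].
  apply: C1c_ortho_ae; first exact: L2B.
  move=> phi Cp; rewrite innerBl//; last exact: C1c_L2.
  by apply/eqP; rewrite subr_eq0 -eqr_opp -H1// H2.
by move=> e; apply: (ae_imp e) => x /(_ I) /eqP; rewrite subr_eq0 => /eqP.
Qed.

(** The du Bois-Reymond lemma: a weak antiderivative is an actual primitive.
Indeed [f - prim g] is orthogonal to the derivative of every test function. *)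
Lemma is_wderiv_primE f g : f \in L2 -> is_wderiv f g ->
  exists k, f = (fun x => k + prim g x) %[ae mu].
Proof.
move=> fL [gL H].
have [||k Hk] := @Cc0_const_ae (fun x => f x - prim g x).
- by apply: L2B => //; exact: prim_L2.
- move=> psi Cp p0; have pL := Cc_L2 Cp; have [C1 E] := Cc_prim_C1c Cp p0.
  rewrite innerBl//; last exact: prim_L2.
  rewrite -{1}E H//.
  by have := prim_ibp gL pL; rewrite p0 mulr0 -opprD => ->; rewrite oppr0.
exists k; apply: (ae_imp Hk) => x /(_ I) /= fx _; rewrite -fx subrK//.
Qed.

(** This allows one to exchange the representatives chosen by [wderiv]. *)
Lemma is_wderiv_ae f f' g : f \in L2 -> f' \in L2 -> f = f' %[ae mu] ->
  is_wderiv f g -> is_wderiv f' g.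
Proof.
move=> fL f'L ff' [gL H]; split=> // phi Cp; rewrite -H//.
apply: inner_ae => //; first by have [/Cc_L2] := C1c_prim Cp.
by apply: (ae_imp ff') => x /(_ I) ->.
Qed.

Lemma wderivP f g : is_wderiv f g -> is_wderiv f (wderiv f).
Proof. by move=> h; rewrite /wderiv; case: xgetP => [? -> //|/(_ g)]. Qed.

Lemma wderiv_ae f g : is_wderiv f g -> wderiv f = g %[ae mu].
Proof. by move=> h; apply: is_wderiv_unique (h); exact: wderivP h. Qed.

End WeakDerivatives.

(** * The Green operator of the Dirichlet Laplacian *)

Section Green.
Context {R : realType}.
Implicit Types (f g h u v w : R -> R) (k K x y : R).
Local Notation mu := (@mu01 R).

(** The derivative of [green w]: the primitive of [- w] whose mean is zero, so
that [green w] vanishes at 1. *)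
Definition slope w : R -> R := fun x => prim (prim w) 1 - prim w x.
Definition green w : R -> R := prim (slope w).

Lemma slope_L2 w : w \in L2 -> slope w \in L2.
Proof. by move=> wL; apply: L2B; [exact: L2_cst|exact: prim_L2]. Qed.

Lemma green_L2 w : w \in L2 -> green w \in L2.
Proof. by move=> wL; apply: prim_L2; exact: slope_L2. Qed.

Lemma prim_cst k x : prim (fun=> k) x = k * prim (fun=> 1) x.
Proof.
have := congr1 (@^~ x) (primZ k (L2_cst (1 : R))) => /= <-; congr (prim _ x).
by apply/funext => t; rewrite mulr1.
Qed.

Lemma prim_cst1 : prim (fun=> 1) 1 = 1 :> R.
Proof. by rewrite prim1E ?int_cst01//; exact: L2_cst. Qed.

Lemma greenE w : w \in L2 ->
  green w = fun x => prim (prim w) 1 * prim (fun=> 1) x - prim (prim w) x.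
Proof.
move=> wL; rewrite /green /slope primB; [|exact: L2_cst|exact: prim_L2].
by apply/funext => x; rewrite prim_cst.
Qed.

Lemma green0 w : w \in L2 -> green w 0 = 0.
Proof. by move=> wL; rewrite /green prim_le0//; exact: slope_L2. Qed.

Lemma green1 w : w \in L2 -> green w 1 = 0.
Proof. by move=> wL; rewrite greenE// prim_cst1 mulr1 subrr. Qed.

Lemma green_continuous w : w \in L2 -> continuous (green w).
Proof. by move=> wL; apply: prim_continuous; exact: slope_L2. Qed.

Lemma slopeD f g : f \in L2 -> g \in L2 ->
  slope (fun x => f x + g x) = fun x => slope f x + slope g x.
Proof.
move=> fL gL; rewrite /slope primD// primD; [|exact: prim_L2|exact: prim_L2].
by apply/funext => x; rewrite opprD addrACA.
Qed.

Lemma slopeZ k f : f \in L2 -> slope (fun x => k * f x) = fun x => k * slope f x.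
Proof.
move=> fL; rewrite /slope primZ// primZ; last exact: prim_L2.
by apply/funext => x; ring.
Qed.

Lemma greenD f g : f \in L2 -> g \in L2 ->
  green (fun x => f x + g x) = fun x => green f x + green g x.
Proof. by move=> fL gL; rewrite /green slopeD// primD//; exact: slope_L2. Qed.

Lemma greenZ k f : f \in L2 -> green (fun x => k * f x) = fun x => k * green f x.
Proof. by move=> fL; rewrite /green slopeZ// primZ//; exact: slope_L2. Qed.

Lemma greenN f : f \in L2 -> green (fun x => - f x) = fun x => - green f x.
Proof.
move=> fL; rewrite (_ : (fun x => - f x) = fun x => -1 * f x); last first.
  by apply/funext => x; rewrite mulN1r.
by rewrite greenZ//; apply/funext => x; rewrite mulN1r.
Qed.

Lemma greenB f g : f \in L2 -> g \in L2 ->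
  green (fun x => f x - g x) = fun x => green f x - green g x.
Proof.
by move=> fL gL; rewrite greenD ?greenN//; exact: L2N.
Qed.

Lemma green_ae f g : f \in L2 -> g \in L2 -> f = g %[ae mu] -> green f = green g.
Proof. by move=> fL gL fg; rewrite /green /slope (prim_ae fL gL fg). Qed.

(** The bound is uniform in x: the solver relies on it to obtain
pointwise convergence from convergence in L^2. *)
Lemma green_bound w x : w \in L2 -> `|green w x| <= 2 * norm2 w.
Proof.
move=> wL; apply: le_trans (prim_bound x (slope_L2 wL)) _.
apply: norm2_bounded; [by apply: L2_mbl; exact: slope_L2|by rewrite mulr_ge0 ?norm2_ge0|].
move=> y _; rewrite mulr_natl mulr2n (le_trans (ler_normB _ _))// lerD//.
  by apply: le_trans (prim_bound _ (prim_L2 wL)) (norm2_prim wL).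
exact: prim_bound.
Qed.

Lemma norm2_green w : w \in L2 -> norm2 (green w) <= 2 * norm2 w.
Proof.
move=> wL; apply: norm2_bounded; [by apply: L2_mbl; exact: green_L2|by rewrite mulr_ge0 ?norm2_ge0|].
by move=> y _; exact: green_bound.
Qed.

(** Integration by parts without boundary terms, since [green f] vanishes at 0
and 1; symmetry and positivity of [green] follow. *)
Lemma inner_green f g : f \in L2 -> g \in L2 ->
  inner (green f) g = inner (slope f) (slope g).
Proof.
move=> fL gL; have sL := slope_L2 fL; have pL := prim_L2 gL.
have := prim_ibp sL gL; rewrite -/(green f) green1// mul0r => /eqP.
rewrite addrC addr_eq0 => /eqP ->.
rewrite [in RHS]/slope innerBr//; last exact: L2_cst.
by rewrite inner_cst// -/(green f) green1// mulr0 sub0r.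
Qed.

Lemma green_sym f g : f \in L2 -> g \in L2 -> inner (green f) g = inner f (green g).
Proof. by move=> fL gL; rewrite inner_green// innerC -inner_green// innerC. Qed.

Lemma inner_green_ge0 f : f \in L2 -> 0 <= inner (green f) f.
Proof. by move=> fL; rewrite inner_green// inner_ge0. Qed.

Lemma is_wderiv_green w : w \in L2 -> is_wderiv (green w) (slope w).
Proof.
move=> /slope_L2 sL; have := is_wderiv_prim 0 sL.
by rewrite (_ : (fun x => _) = green w)//; apply/funext => x; rewrite add0r.
Qed.

Lemma is_wderiv_slope w : w \in L2 -> is_wderiv (slope w) (fun x => - w x).
Proof.
move=> wL; have := is_wderiv_prim (prim (prim w) 1) (L2N wL).
rewrite (_ : (fun x => _ + _) = slope w)//; apply/funext => x; rewrite /slope.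
congr (_ + _); rewrite -mulN1r; have := congr1 (@^~ x) (primZ (-1) wL) => /= <-; congr (prim _ x).
by apply/funext => t; rewrite mulN1r.
Qed.

(** Stated for any representative f of [green w], so that it can be applied
again to the Laplacian itself, which is only known up to a null set. *)
Lemma laplacian_green f w : w \in L2 -> f \in L2 -> f = green w %[ae mu] ->
  [/\ is_wderiv f (wderiv f), is_wderiv (wderiv f) (laplacian f) &
      laplacian f = (fun x => - w x) %[ae mu]].
Proof.
move=> wL fL fg.
have gf : green w = f %[ae mu] by apply: (ae_imp fg) => x /(_ I) ->.
have W1 := is_wderiv_ae (green_L2 wL) fL gf (is_wderiv_green wL).
have W1' := wderivP W1.
have ws : slope w = wderiv f %[ae mu].
  by apply: (ae_imp (wderiv_ae W1)) => x /(_ I) ->.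
have W2 := is_wderiv_ae (slope_L2 wL) W1'.1 ws (is_wderiv_slope wL).
by split; [exact: W1'|exact: wderivP W2|exact: wderiv_ae W2].
Qed.

(** By du Bois-Reymond f is an affine function plus an iterated primitive of
its second derivative; the two boundary values determine the affine part. *)
Lemma green_laplacian f g h : f \in L2 -> is_wderiv f g -> is_wderiv g h ->
  zero_at_bnd f -> f = green (fun x => - h x) %[ae mu].
Proof.
move=> fL fg gh [z [cz fz z0 z1]].
have gL := fg.1; have hL := gh.1.
have [c0 f0] := is_wderiv_primE fL fg.
have [c1 g1] := is_wderiv_primE gL gh.
have PL := prim_L2 hL.
have E : prim g = fun x => c1 * prim (fun=> 1) x + prim (prim h) x.
  rewrite (prim_ae gL _ g1); last by apply: L2D => //; exact: L2_cst.
  by rewrite primD//; [apply/funext => x; rewrite prim_cst|exact: L2_cst].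
pose F x := c0 + prim g x.
have cF : {within `[0, 1], continuous F}.
  apply: continuous_subspaceT => x; apply: cvgD; [exact: cvg_cst|exact: prim_continuous].
have zF : z = F %[ae mu].
  by apply: (ae_imp2 fz f0) => x /(_ I) fx /(_ I) fx' _; rewrite -fx fx'.
have H := continuous_ae_eq cz cF zF.
have c00 : c0 = 0.
  by have := H 0; rewrite lexx ler01 z0 /F prim_le0 ?lexx// addr0 => /(_ isT).
have c1E : c1 = - prim (prim h) 1.
  have := H 1; rewrite lexx ler01 z1 /F c00 add0r E prim_cst1 mulr1 => /(_ isT) /esym/eqP.
  by rewrite addr_eq0 => /eqP.
rewrite greenN// greenE//.
by apply: (ae_imp f0) => x /(_ I) -> _; rewrite c00 E c1E; ring.
Qed.

Lemma zero_at_bnd_green f w : w \in L2 -> f = green w %[ae mu] -> zero_at_bnd f.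
Proof.
move=> wL fg; exists (green w); split=> //; [|exact: green0|exact: green1].
by apply: continuous_subspaceT; exact: green_continuous.
Qed.

(** Together with [dom_LP] this identifies the domain of L with the range of
the square of [green]. *)
Lemma dom_L_green2 w : w \in L2 -> let u := green (green w) in
  [/\ dom_L u, laplacian u = (fun x => - green w x) %[ae mu] &
      laplacian (laplacian u) = w %[ae mu]].
Proof.
move=> wL u; have vL := green_L2 wL; have uL := green_L2 vL.
have refl : u = green (green w) %[ae mu] by apply: ae01.
have [u1 u2 lap] := laplacian_green vL uL refl.
have lap' : laplacian u = green (fun x => - w x) %[ae mu] by rewrite greenN.
have nL := L2N wL.
have [u3 u4 laplap] := laplacian_green nL u2.1 lap'.
have llE : laplacian (laplacian u) = w %[ae mu].
  by apply: (ae_imp laplap) => x /(_ I) ->; rewrite opprK.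
split; [split|exact: lap|exact: llE].
- split; first exact: uL.
  exists (wderiv u); split; first exact: u1.
  split; first exact: u1.1.
  exists (laplacian u); split; first exact: u2.
  split; first exact: u2.1.
  exists (wderiv (laplacian u)); split; first exact: u3.
  split; first exact: u3.1.
  exists (laplacian (laplacian u)); split; first exact: u4.
  by split; first exact: u4.1.
- exact: zero_at_bnd_green refl.
- exact: zero_at_bnd_green lap'.
Qed.

(** The derivatives in [Hsob 4 u] are arbitrary representatives; they are first
exchanged for those selected by [wderiv], then [green_laplacian] applies twice. *)
Lemma dom_LP u : dom_L u -> [/\ u \in L2, laplacian u \in L2,
  laplacian (laplacian u) \in L2,
  laplacian u = (fun x => - green (laplacian (laplacian u)) x) %[ae mu] &
  u = green (green (laplacian (laplacian u))) %[ae mu]].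
Proof.
move=> [[uL [g1 [w1 [g1L [g2 [w2 [g2L [g3 [w3 [g3L [g4 [w4 [g4L _]]]]]]]]]]]]] z0 z2].
have W1 : is_wderiv u (wderiv u) := wderivP w1.
have e1 : g1 = wderiv u %[ae mu] by apply: (ae_imp (wderiv_ae w1)) => x /(_ I) ->.
have w2' := is_wderiv_ae g1L W1.1 e1 w2.
have W2 : is_wderiv (wderiv u) (laplacian u) := wderivP w2'.
have e2 : g2 = laplacian u %[ae mu].
  by apply: (ae_imp (wderiv_ae w2')) => x /(_ I) e _; exact/esym.
have w3' := is_wderiv_ae g2L W2.1 e2 w3.
have W3 : is_wderiv (laplacian u) (wderiv (laplacian u)) := wderivP w3'.
have e3 : g3 = wderiv (laplacian u) %[ae mu].
  by apply: (ae_imp (wderiv_ae w3')) => x /(_ I) ->.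
have w4' := is_wderiv_ae g3L W3.1 e3 w4.
have W4 : is_wderiv (wderiv (laplacian u)) (laplacian (laplacian u)) := wderivP w4'.
move: W4 {w4' e3 w3' e2 w2' w2 w3 w4 w1 e1}.
move: (laplacian (laplacian u)) (wderiv (laplacian u)) W3 => ll d3 W3 W4.
move: (laplacian u) z2 W3 W2 => l z2 W3 W2.
have E2 := green_laplacian W2.1 W3 W4 z2; rewrite (greenN W4.1) in E2.
have E0 := green_laplacian uL W1 W2 z0.
have gL := green_L2 W4.1.
split; [exact: uL|exact: W2.1|exact: W4.1|exact: E2|].
rewrite -(green_ae (L2N W2.1) gL); first exact: E0.
by apply: (ae_imp E2) => y /(_ I) ->; rewrite opprK.
Qed.

End Green.

(** * Solving the fourth-order equation *)

Opaque inner wderiv.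

Section Solve.
Context {R : realType}.
Implicit Types (f g h u v w : R -> R) (k K x y : R).
Local Notation mu := (@mu01 R).

Lemma geometric_eq0 (c C q : R) : 0 <= q < 1 -> (forall n, `|c| <= C * q ^+ n) -> c = 0.
Proof.
move=> /andP[q0 q1] H; apply/eqP; rewrite -normr_le0.
have cv : C * q ^+ n @[n --> \oo] --> 0.
  rewrite -(mulr0 C); apply: cvgM; first exact: cvg_cst.
  by apply: cvg_expr; rewrite ger0_norm.
rewrite -(cvg_lim (@Rhausdorff R) cv); apply: limr_ge; first exact: cvgP cv.
by apply: nearW => n; exact: H.
Qed.

(** The pointwise limit of a geometrically convergent series of functions,
with its error bound.  Working pointwise gives a measurable sum without any appeal to
the completeness of L^2. *)
Lemma geometric_limit (d : nat -> R -> R) (S q : R) : 0 <= q < 1 ->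
  (forall n, mblfun (d n)) -> (forall n x, `|d n x| <= S * q ^+ n) ->
  exists2 v, mblfun v &
    forall n x, `|v x - \sum_(0 <= k < n) d k x| <= S / (1 - q) * q ^+ n.
Proof.
move=> /andP[q0 q1] md dS.
have q1' : 1 - q != 0 by rewrite subr_eq0 gt_eqF.
have S0 : 0 <= S by have := dS 0%N 0; rewrite expr0 mulr1; apply: le_trans.
pose v n x := \sum_(0 <= k < n) d k x.
have cvx x : cvgn (fun n => v n x).
  apply: (@normed_cvg _ _ (fun n => d n x)).
  apply: (@series_le_cvg _ _ (geometric S q)) => //.
  - by move=> n; rewrite /= normr_ge0.
  - by move=> n; rewrite /geometric/= mulr_ge0// exprn_ge0.
  - by move=> n; exact: dS.
  - by apply: is_cvg_geometric_series; rewrite ger0_norm.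
have tail n j x : `|v (n + j)%N x - v n x| <= S / (1 - q) * (q ^+ n - q ^+ (n + j)).
  elim: j => [|j IH]; first by rewrite addn0 !subrr normr0 mulr0.
  rewrite addnS {1}/v big_nat_recr//= -/(v (n + j)%N x) addrAC.
  apply: le_trans (ler_normD _ _) _; apply: le_trans (lerD IH (dS _ _)) _.
  rewrite le_eqVlt; apply/orP; left; apply/eqP; rewrite exprS; field.
  by rewrite q1'.
exists (fun x => lim (v n x @[n --> \oo])).
  apply: (@measurable_fun_cvg _ _ _ _ v) => [n|x _]; last exact: cvx.
  rewrite /v; elim: n => [|n IH].
    rewrite (_ : (fun x => _) = fun=> 0); first exact: mbl_cst.
    by apply/funext => x; rewrite big_nil.
  rewrite (_ : (fun x => _) = fun x => v n x + d n x); first exact: mblD.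
  by apply/funext => x; rewrite big_nat_recr.
move=> n x; rewrite -/(v n x).
have cv : `|v m x - v n x| @[m --> \oo] --> `|lim (v n x @[n --> \oo]) - v n x|.
  by apply: cvg_norm; apply: cvgB; [exact: cvx|exact: cvg_cst].
rewrite -(cvg_lim (@Rhausdorff R) cv); apply: limr_le; first exact: cvgP cv.
exists n => // m /= nm; rewrite -(subnKC nm).
apply: le_trans (tail _ _ _) _; rewrite ler_wpM2l//.
  by rewrite divr_ge0// subr_ge0 ltW.
by rewrite gerBl exprn_ge0.
Qed.

Section FormOperator.
Variables (eps lam K : R) (c : R -> R).
Hypotheses (eps0 : 0 < eps) (lam0 : 0 <= lam) (K0 : 0 <= K).
Hypotheses (cK : ae_bounded c K) (c0 : forall x, 0 <= c x).

Definition potential v : R -> R := green (fun x => c x * green v x).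
(** The operator [eps + lam G + G c G], whose quadratic form is the energy; unlike
the differential operator it is bounded on L^2. *)
Definition form_op v : R -> R := fun x => eps * v x + (lam * green v x + potential v x).

Lemma coef_L2 f : f \in L2 -> (fun x => c x * f x) \in L2.
Proof. exact: L2M cK. Qed.

Lemma coef_green_L2 f : f \in L2 -> (fun x => c x * green f x) \in L2.
Proof. by move=> fL; apply: coef_L2; exact: green_L2. Qed.

Lemma potential_L2 v : v \in L2 -> potential v \in L2.
Proof. by move=> vL; apply: green_L2; exact: coef_green_L2. Qed.

Lemma form_op_L2 v : v \in L2 -> form_op v \in L2.
Proof.
move=> vL; apply: L2D; first exact: L2Z.
by apply: L2D; [apply: L2Z; exact: green_L2|exact: potential_L2].
Qed.

Lemma potentialD f g : f \in L2 -> g \in L2 ->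
  potential (fun x => f x + g x) = fun x => potential f x + potential g x.
Proof.
move=> fL gL; rewrite /potential greenD// -greenD; [|exact: coef_green_L2|exact: coef_green_L2].
by congr green; apply/funext => x; rewrite mulrDr.
Qed.

Lemma potentialZ k f : f \in L2 -> potential (fun x => k * f x) = fun x => k * potential f x.
Proof.
move=> fL; rewrite /potential greenZ// -greenZ; last exact: coef_green_L2.
by congr green; apply/funext => x; rewrite mulrCA.
Qed.

Lemma form_opD f g : f \in L2 -> g \in L2 ->
  form_op (fun x => f x + g x) = fun x => form_op f x + form_op g x.
Proof.
move=> fL gL; rewrite /form_op (greenD fL gL) (potentialD fL gL); apply/funext => x /=.
by rewrite !mulrDr [in RHS]addrACA; congr (_ + _); rewrite [in RHS]addrACA.
Qed.

Lemma form_opZ k f : f \in L2 -> form_op (fun x => k * f x) = fun x => k * form_op f x.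
Proof. by move=> fL; rewrite /form_op (greenZ _ fL) (potentialZ _ fL); apply/funext => x /=; rewrite !mulrDr !(mulrCA k). Qed.

Lemma potential_bound v x : v \in L2 -> `|potential v x| <= 4 * K * norm2 v.
Proof.
move=> vL; apply: le_trans (green_bound _ (coef_green_L2 vL)) _.
have h1 := norm2M K0 cK (green_L2 vL).
have h2 : K * norm2 (green v) <= K * (2 * norm2 v) by rewrite ler_wpM2l// norm2_green.
by apply: le_trans (ler_wpM2l _ (le_trans h1 h2)) _ => //; rewrite le_eqVlt; apply/orP; left; apply/eqP; ring.
Qed.

Lemma norm2_potential v : v \in L2 -> norm2 (potential v) <= 4 * K * norm2 v.
Proof.
move=> vL; apply: norm2_bounded; [by apply: L2_mbl; exact: potential_L2| |].
  by rewrite !mulr_ge0 ?norm2_ge0.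
by move=> y _; exact: potential_bound.
Qed.

Lemma norm2_form_op v : v \in L2 -> norm2 (form_op v) <= (eps + (2 * lam + 4 * K)) * norm2 v.
Proof.
move=> vL; have gL := green_L2 vL; have pL := potential_L2 vL.
apply: le_trans (norm2D (L2Z _ vL) (L2D (L2Z _ gL) pL)) _.
apply: le_trans (lerD (lexx _) (norm2D (L2Z _ gL) pL)) _.
rewrite !norm2Z// !ger0_norm ?(ltW eps0)//.
have h1 : lam * norm2 (green v) <= 2 * lam * norm2 v by rewrite (mulrC 2) -mulrA ler_wpM2l// norm2_green.
by rewrite mulrDl (mulrDl (2 * lam)) lerD2l lerD// norm2_potential.
Qed.

(** Coercivity: the operators G and [G c G] are nonnegative. *)
Lemma inner_form_op v : v \in L2 -> eps * inner v v <= inner (form_op v) v.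
Proof.
move=> vL; have gL := green_L2 vL; have pL := potential_L2 vL.
rewrite innerDl//; [|exact: L2Z|by apply: L2D => //; exact: L2Z].
rewrite innerDl//; last exact: L2Z.
rewrite (innerZl _ vL vL) (innerZl _ gL vL) /potential (green_sym (coef_green_L2 vL) vL).
rewrite lerDl addr_ge0//; first by rewrite mulr_ge0// inner_green_ge0.
by apply: inner_ge0_ptw => x; rewrite -mulrA mulr_ge0// -expr2 sqr_ge0.
Qed.

(** Coercivity and boundedness make the iteration [d |-> d - tau * A d] a
contraction of L^2 for small tau, and its iterates starting from [tau * G f] sum up to
the solution v.  They even decay uniformly: [d - tau * A d] is [1 - tau * eps] times d
plus a term that [green_bound] controls by the L^2 norm of d. *)
Lemma form_op_solve f : f \in L2 -> exists2 v, v \in L2 & forall x, form_op v x = green f x.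
Proof.
(* L bounds the norm of the operator; the summand 1 only serves to make it exceed eps *)
move: eps0 lam0 K0 => e0 l0 k0 fL; set L := eps + (2 * lam + 4 * K) + 1.
have L0 : 0 < L by rewrite /L; lra.
have epsL : eps < L by rewrite /L; lra.
pose tau := eps / L ^+ 2; have tau0 : 0 < tau by rewrite divr_gt0// exprn_gt0.
have te : 0 < tau * eps < 1.
  rewrite mulr_gt0//= /tau mulrAC -expr2 ltr_pdivrMr ?exprn_gt0// mul1r.
  by rewrite ltr_sqr ?nnegrE ?ltW.
have tauL : tau * L ^+ 2 = eps by rewrite /tau divfK// gt_eqF// exprn_gt0.
(* by coercivity, r is the contraction factor for the squared norm *)
clearbody tau; pose r := 1 - tau * eps.
have [r0 r1] : 0 < r /\ r < 1 by rewrite /r; split; lra.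
pose d := fix d n : R -> R := if n is n'.+1 then fun x => d n' x - tau * form_op (d n') x
  else fun x => tau * green f x.
have dL n : d n \in L2.
  elim: n => [|n IH] /=; first by apply: L2Z; exact: green_L2.
  by apply: L2B => //; apply: L2Z; exact: form_op_L2.
(* the norms of the iterates decay like the powers of q *)
pose q := Num.sqrt r.
have q0 : 0 < q by rewrite sqrtr_gt0.
have qq : q ^+ 2 = r by rewrite sqr_sqrtr// ltW.
have q1 : q < 1 by rewrite -(ltr_sqr) ?nnegrE ?ltW// qq expr1n.
have rq : r <= q by rewrite -qq expr2 ler_piMr// ltW.
have dN n : norm2 (d n) <= q ^+ n * norm2 (d 0%N).
  elim: n => [|n IH]; first by rewrite expr0 mul1r.
  apply: (@le_trans _ _ (q * norm2 (d n))); last first.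
    by rewrite exprS -mulrA ler_wpM2l// ltW.
  rewrite -ler_sqr ?nnegrE ?mulr_ge0 ?norm2_ge0 ?(ltW q0)// exprMn qq !norm2_sqr /=.
  have AL := form_op_L2 (dL n); have tL := L2Z tau AL; have n_L := dL n.
  rewrite innerBl//; last exact: L2B.
  rewrite !innerBr// !innerZl// !innerZr// (innerC (d n) (form_op _)).
  have := inner_form_op n_L; have := norm2_form_op n_L; rewrite -(norm2_sqr (form_op _)) -!(norm2_sqr (d n)).
  set X := norm2 (form_op _); set Y := norm2 (d n); set Z := inner _ _ => XY ZY.
  have [X0 Y0] : 0 <= X /\ 0 <= Y by rewrite !norm2_ge0.
  have XL : X ^+ 2 <= L ^+ 2 * Y ^+ 2.
    rewrite -exprMn ler_sqr ?nnegrE ?mulr_ge0// ?(ltW L0)//.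
    by apply: le_trans XY _; rewrite ler_wpM2r// /L; lra.
  have T1 : tau * tau * X ^+ 2 <= tau * eps * Y ^+ 2.
    rewrite -(mulrA tau) -(mulrA tau eps) ler_wpM2l ?(ltW tau0)//.
    apply: (@le_trans _ _ (tau * (L ^+ 2 * Y ^+ 2))); first by rewrite ler_wpM2l ?(ltW tau0).
    by rewrite mulrA tauL.
  have T2 : tau * eps * Y ^+ 2 <= tau * Z by rewrite -mulrA ler_wpM2l ?(ltW tau0).
  rewrite /r; nra.
pose B := tau * ((2 * lam + 4 * K) * norm2 (d 0%N)).
have B0 : 0 <= B.
  by rewrite mulr_ge0 ?(ltW tau0)// mulr_ge0 ?norm2_ge0// addr_ge0// mulr_ge0.
(* the uniform decay has any larger rate; the slack pays for the L^2 term B *)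
pose q' := (1 + q) / 2.
have [q'0 q'1 qq'] : [/\ 0 < q', q' < 1 & q < q'] by rewrite /q'; split; lra.
pose S := tau * (2 * norm2 f) + B / (q' - q).
have dq : 0 < q' - q by lra.
have tf0 : 0 <= tau * (2 * norm2 f) by apply: mulr_ge0 (ltW tau0) _; rewrite mulr_ge0 ?norm2_ge0.
have Bq0 : 0 <= B / (q' - q) := divr_ge0 B0 (ltW dq).
have S0 : 0 <= S by rewrite addr_ge0.
have SB : B <= S * (q' - q).
  rewrite /S mulrDl divfK ?(gt_eqF dq)// lerDr.
  by rewrite mulr_ge0// ltW.
have dS n x : `|d n x| <= S * q' ^+ n.
  elim: n => [|n IH] /=.
    rewrite expr0 mulr1 normrM (gtr0_norm tau0) /S.
    apply: (@le_trans _ _ (tau * (2 * norm2 f))).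
      by rewrite ler_wpM2l ?(ltW tau0)// green_bound.
    by rewrite lerDl.
  have -> : d n x - tau * form_op (d n) x =
      r * d n x - tau * (lam * green (d n) x + potential (d n) x).
    rewrite /form_op /r; move: (d n x) (green _ x) (potential _ x) => X Y Z; ring.
  apply: le_trans (ler_normB _ _) _; rewrite !normrM (gtr0_norm r0) (gtr0_norm tau0).
  have E1 : `|lam * green (d n) x + potential (d n) x| <= (2 * lam + 4 * K) * norm2 (d n).
    apply: le_trans (ler_normD _ _) _; rewrite normrM (ger0_norm lam0).
    rewrite mulrDl lerD ?potential_bound// (mulrC 2) -mulrA ler_wpM2l//.
    exact: green_bound.
  have E2 : tau * `|lam * green (d n) x + potential (d n) x| <= B * q' ^+ n.
    rewrite /B -mulrA ler_wpM2l ?(ltW tau0)//; apply: le_trans E1 _.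
    rewrite -mulrA ler_wpM2l//; first by rewrite addr_ge0// mulr_ge0.
    apply: le_trans (dN n) _; rewrite mulrC ler_wpM2l ?norm2_ge0//.
    by apply: lerXn2r; rewrite ?nnegrE ltW.
  have E3 : r * `|d n x| <= q * (S * q' ^+ n) by apply: ler_pM => //; exact: ltW.
  apply: le_trans (lerD E3 E2) _.
  have := exprn_ge0 n (ltW q'0); rewrite exprS; nra.
have q'01 : 0 <= q' < 1 by rewrite (ltW q'0).
have [v mv vd] := geometric_limit q'01 (fun n => L2_mbl (dL n)) dS.
set T := S / (1 - q') in vd.
have T0 : 0 <= T by rewrite divr_ge0// subr_ge0 ltW.
have vL : v \in L2.
  apply: (@L2_bounded _ _ T) => // x _.
  by have := vd 0%N x; rewrite big_nil subr0 expr0 mulr1.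
pose s n x := \sum_(0 <= k < n) d k x.
have sL n : s n \in L2.
  elim: n => [|n IH].
    rewrite (_ : s 0%N = fun=> 0); first exact: L2_cst.
    by apply/funext => x; rewrite /s big_nil.
  rewrite (_ : s n.+1 = fun x => s n x + d n x); first exact: L2D.
  by apply/funext => x; rewrite /s big_nat_recr.
(* each iterate is the residual of the previous partial sum, times tau *)
have ds n x : d n x = tau * (green f x - form_op (s n) x).
  elim: n x => [|n IH] x.
    rewrite (_ : s 0%N = fun x => 0 * green f x); last first.
      by apply/funext => y; rewrite /s big_nil mul0r.
    by rewrite form_opZ ?mul0r ?subr0//; exact: green_L2.
  rewrite (_ : s n.+1 = fun x => s n x + d n x); last first.
    by apply/funext => y; rewrite /s big_nat_recr.
  rewrite form_opD//= {1}IH; move: (green f x) (form_op _ x) (form_op _ x) => X Y Z; ring.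
exists v => // x; apply/eqP; rewrite -subr_eq0; apply/eqP.
apply: (@geometric_eq0 _ (S / tau + L * T) q') => // n.
have wL : (fun x => v x - s n x) \in L2 by exact: L2B.
have -> : form_op v x - green f x = form_op (fun x => v x - s n x) x - d n x / tau.
  rewrite ds (_ : form_op v = form_op (fun x => (v x - s n x) + s n x)); last first.
    by congr form_op; apply/funext => y; rewrite subrK.
  rewrite form_opD//; move: (green f x) (form_op _ x) (form_op _ x) => X Y Z.
  by field; rewrite gt_eqF.
have Nw : norm2 (fun x => v x - s n x) <= T * q' ^+ n.
  apply: norm2_bounded; [exact: L2_mbl| |by move=> y _; exact: vd].
  by rewrite mulr_ge0// exprn_ge0// ltW.
apply: le_trans (ler_normB _ _) _; rewrite addrC mulrDl lerD//.
  rewrite normrM normfV (gtr0_norm tau0) mulrAC ler_wpM2r ?invr_ge0 ?(ltW tau0)//.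
have P0 : 0 <= T * q' ^+ n by rewrite mulr_ge0// exprn_ge0// ltW.
have w1 := vd n x; rewrite -/(s n x) in w1.
have w2 := green_bound x wL; have w3 := potential_bound x wL.
rewrite /form_op; apply: le_trans (ler_normD _ _) _.
apply: le_trans (lerD (lexx _) (ler_normD _ _)) _.
rewrite !normrM (gtr0_norm eps0) (ger0_norm lam0) -mulrA.
have a1 : eps * `|v x - s n x| <= eps * (T * q' ^+ n) by rewrite ler_wpM2l// ltW.
have a2 : lam * `|green (fun x => v x - s n x) x| <= 2 * lam * (T * q' ^+ n).
  rewrite (mulrC 2) -mulrA ler_wpM2l//; apply: le_trans w2 _.
  by rewrite ler_wpM2l.
have a3 : `|potential (fun x => v x - s n x) x| <= 4 * K * (T * q' ^+ n).
  by apply: le_trans w3 _; rewrite ler_wpM2l// mulr_ge0.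
apply: le_trans (lerD a1 (lerD a2 a3)) _.
rewrite -!mulrDl; apply: ler_wpM2r => //.
by rewrite /L lerDl.
Qed.

End FormOperator.

(** If [A v = G f] then [v = G w] for [w = (f - lam v - c G v) / eps], and this w
solves the equation for [u = G (G w)]. *)
Lemma L_solve eps lam K c f : 0 < eps -> 0 <= lam -> 0 <= K -> ae_bounded c K ->
  (forall x, 0 <= c x) -> f \in L2 ->
  exists2 w, w \in L2 & forall x,
    eps * w x + lam * green w x + c x * green (green w) x = f x.
Proof.
move=> e0 l0 K0 cK c0 fL.
have [v vL Av] := form_op_solve e0 l0 K0 cK c0 fL.
have gL := green_L2 vL; have cgL := coef_green_L2 cK vL.
have hL : (fun x => f x - (lam * v x + c x * green v x)) \in L2.
  by apply: L2B => //; apply: L2D => //; exact: L2Z.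
pose w x := eps^-1 * (f x - (lam * v x + c x * green v x)).
have wL : w \in L2 by exact: L2Z.
have wv : green w = v.
  rewrite /w greenZ// greenB//; last by apply: L2D => //; exact: L2Z.
  rewrite greenD//; last exact: L2Z.
  rewrite greenZ//; apply/funext => x; rewrite -(Av x) /form_op /potential.
  move: (v x) (green v x) (green (fun x => _) x) => X Y Z.
  by field; rewrite gt_eqF.
exists w => [//|x]; rewrite wv /w; move: (v x) (green v x) (f x) (c x) => X Y Z C.
by field; rewrite gt_eqF.
Qed.

End Solve.

(** * The energy form and the limit of the Hessian *)

Opaque prim green.

Section Energy.
Context {R : realType}.
Implicit Types (f g h u v w theta : R -> R) (k K x y : R).
Local Notation mu := (@mu01 R).

Lemma inner_mulC c f g : inner (fun x => c x * f x) g = inner (fun x => c x * g x) f.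
Proof. by apply: eq_inner => x; rewrite mulrAC. Qed.

Lemma innerBB f1 f2 g1 g2 : f1 \in L2 -> f2 \in L2 -> g1 \in L2 -> g2 \in L2 ->
  inner (fun x => f1 x - f2 x) (fun x => g1 x - g2 x) =
  inner f1 g1 - inner f1 g2 - inner f2 g1 + inner f2 g2.
Proof.
move=> f1L f2L g1L g2L; rewrite (innerBl f1L f2L (L2B g1L g2L)).
rewrite (innerBr g1L g2L f1L) (innerBr g1L g2L f2L).
by rewrite opprB addrA addrAC.
Qed.

Lemma form_arith (eps lam a b c a1 a2 a3 a4 b1 b2 b3 b4 c1 c2 c3 c4 : R) :
  a = a1 - a2 - a3 + a4 -> b = b1 - b2 - b3 + b4 -> c = c1 - c2 - c3 + c4 ->
  eps * a + (lam * b + c) = eps * a1 + (lam * b1 + c1) - (eps * a2 + (lam * b2 + c2))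
    - (eps * a3 + (lam * b3 + c3)) + (eps * a4 + (lam * b4 + c4)).
Proof. by move=> -> -> ->; ring. Qed.

Lemma form_congr (eps lam a b c a' b' c' : R) : a = a' -> b = b' -> c = c' ->
  eps * a + (lam * b + c) = eps * a' + (lam * b' + c').
Proof. by move=> -> -> ->. Qed.

(** The arithmetic of [weak_sol_antitone], with each inner product replaced
by a real number. *)
Lemma antitone_arith (F a b c d e J J' : R) : 0 <= F -> F = a - b - c + d -> c = b ->
  J = a -> J' = b -> J' = e -> d <= e -> J' <= J.
Proof. by move=> F0 FE cb Ja Jb Je de; move: F0; rewrite FE; lra. Qed.

Lemma twice_arith (J P S : R) : P <= J -> 2 * J - P <= S -> J <= S.
Proof. lra. Qed.

(** The maximum of [2 r T U - C U ^+ 2] over U, by completing the square. *)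
Lemma square_arith (C r T U s : R) : 0 < C -> r ^+ 2 <= C * s ->
  (2 * (r * T) - C * U) * U <= s * T * T.
Proof.
move=> C0 rs; rewrite -subr_ge0 -(pmulr_rge0 _ C0).
have -> : C * (s * T * T - (2 * (r * T) - C * U) * U) =
    (C * U - r * T) ^+ 2 + (C * s - r ^+ 2) * T ^+ 2 by ring.
by rewrite addr_ge0 ?sqr_ge0// mulr_ge0 ?sqr_ge0// subr_ge0.
Qed.

Section Form.
Variables (lam K : R) (c : R -> R).
Hypotheses (lam0 : 0 <= lam) (K0 : 0 <= K).
Hypotheses (cK : ae_bounded c K) (c0 : forall x, 0 <= c x).

(** The weak form of the equation [L u = f] for [u = green v], tested against
[green h]. *)
Definition form (eps : R) g h := eps * inner g h + (lam * inner (green g) h +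
  inner (fun x => c x * green g x) (green h)).

Lemma formBB eps g h : g \in L2 -> h \in L2 ->
  form eps (fun x => g x - h x) (fun x => g x - h x) =
  form eps g g - form eps g h - form eps h g + form eps h h.
Proof.
move=> gL hL; have ggL := green_L2 gL; have ghL := green_L2 hL.
have cgL := L2M cK ggL; have chL := L2M cK ghL.
have E1 := innerBB gL hL gL hL.
have E2 := innerBB ggL ghL gL hL.
have E3 := innerBB cgL chL ggL ghL.
have cE : (fun x => c x * green (fun x => g x - h x) x) =
    (fun x => c x * green g x - c x * green h x).
  by apply/funext => x; rewrite (greenB gL hL) mulrBr.
have gE := greenB gL hL.
have F2 := etrans (congr1 (fun z => inner z (fun x => g x - h x)) gE) E2.
have F3 := etrans (congr2 inner cE gE) E3.
exact: (form_arith eps lam E1 F2 F3).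
Qed.

Lemma form_sym eps g h : g \in L2 -> h \in L2 -> form eps g h = form eps h g.
Proof.
move=> gL hL; rewrite /form.
exact: (form_congr eps lam (innerC g h) (etrans (green_sym gL hL) (innerC g (green h)))
  (inner_mulC c (green g) (green h))).
Qed.

Lemma form_ge eps g : 0 <= eps -> g \in L2 ->
  inner (fun x => c x * green g x) (green g) <= form eps g g.
Proof.
move=> e0 gL; rewrite /form addrA lerDr addr_ge0// mulr_ge0 ?inner_ge0//.
exact: inner_green_ge0.
Qed.

Lemma form_ge0 eps g : 0 <= eps -> g \in L2 -> 0 <= form eps g g.
Proof.
move=> e0 gL; apply: le_trans (form_ge e0 gL); apply: inner_ge0_ptw => x.
by rewrite -mulrA mulr_ge0// -expr2 sqr_ge0.
Qed.

Definition weak_sol eps f v := forall g, g \in L2 -> inner f (green g) = form eps v g.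

(** By symmetry the equation gives [<f, G v> = form v v] and
[<f, G v'> = form v v'], so that nonnegativity of [form (v - v') (v - v')] yields
[<f, G v> >= 2 <f, G v'> - form v' v'], and the form at eps is smaller than at eps'. *)
Lemma weak_sol_antitone eps eps' f v v' : 0 < eps -> eps <= eps' -> v \in L2 -> v' \in L2 ->
  weak_sol eps f v -> weak_sol eps' f v' -> inner f (green v') <= inner f (green v).
Proof.
move=> e0 ee vL vL' Hv Hv'.
have h : form eps v' v' <= form eps' v' v'.
  by rewrite /form lerD2r ler_wpM2r// inner_ge0.
exact: (antitone_arith (form_ge0 (ltW e0) (L2B vL vL')) (formBB eps vL vL')
  (form_sym eps vL' vL) (Hv _ vL) (Hv _ vL') (Hv' _ vL') h).
Qed.

Lemma weak_sol_ge0 eps f v : 0 < eps -> v \in L2 -> weak_sol eps f v ->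
  0 <= inner f (green v).
Proof. by move=> e0 vL Hv; rewrite Hv// form_ge0// ltW. Qed.

End Form.

Section Inverse.
Variables (lam kap m M : R) (rho_x : R -> R).
Hypotheses (lam0 : 0 <= lam) (m0 : 0 < m) (mkap : m ^+ 2 < kap).
Hypotheses (rL : rho_x \in L2) (rM : {ae mu, forall x, m <= `|rho_x x| <= M}).

Let c x := kap + rho_x x ^+ 2.

Lemma kap_gt0 : 0 < kap.
Proof. by apply: lt_trans mkap; rewrite exprn_gt0. Qed.

Lemma coef_ge0 x : 0 <= c x.
Proof. by rewrite addr_ge0 ?sqr_ge0// ltW// kap_gt0. Qed.

Lemma ae_bounded_rho : ae_bounded rho_x M.
Proof. by split; [exact: L2_mbl|apply: (ae_imp rM) => x /andP[]]. Qed.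

Lemma ae_bounded_coef : ae_bounded c (kap + M ^+ 2).
Proof.
split; first by apply: mblD; [exact: mbl_cst|apply: measurable_funX; exact: L2_mbl].
apply: (ae_imp rM) => x /andP[_ xM]; rewrite ger0_norm ?coef_ge0// lerD2l.
by rewrite -[leLHS]real_normK ?num_real// ler_sqr ?nnegrE// (le_trans _ xM).
Qed.

Lemma coef_bound_ge0 : 0 <= kap + M ^+ 2.
Proof. by rewrite addr_ge0 ?sqr_ge0// ltW// kap_gt0. Qed.

Lemma L_invP eps f : 0 < eps -> f \in L2 ->
  exists2 w, w \in L2 & [/\ L_inv eps lam kap rho_x f \in L2,
    L_inv eps lam kap rho_x f = green (green w) %[ae mu] &
    f = (fun x => eps * w x + lam * green w x + c x * green (green w) x) %[ae mu]].
Proof.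
move=> e0 fL.
set P : set (R -> R) := [set u | dom_L u /\ L_op eps lam kap rho_x u = f %[ae mu]].
have [w0 w0L Hw0] := L_solve e0 lam0 coef_bound_ge0 ae_bounded_coef coef_ge0 fL.
have P0 : P (green (green w0)).
  have [D l ll] := dom_L_green2 w0L; split; first exact: D.
  apply: (ae_imp2 l ll) => x /(_ I) lx /(_ I) llx _.
  by rewrite /L_op lx llx mulrN opprK -Hw0.
have : P (L_inv eps lam kap rho_x f) := xgetPex (cst 0) (ex_intro _ _ P0).
move: (L_inv _ _ _ _ _) => u [/dom_LP].
rewrite /L_op; move: (laplacian (laplacian u)) => w; move: (laplacian u) => l.
move=> [uL lL wL lE uE] LE; exists w => //; split=> //.
apply: (ae_imp2 lE (ae_imp2 uE LE (fun x a b => conj a b))) => x /(_ I) lx [/(_ I) ux /(_ I) Lx] _.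
by rewrite -Lx lx ux mulrN opprK.
Qed.

(** Whichever solution [L_inv] selects, it equals [green v] almost everywhere for
some weak solution v, and this determines [<f, L_inv f>]. *)
Lemma L_inv_weak eps f : 0 < eps -> f \in L2 ->
  exists2 v, v \in L2 & [/\ L_inv eps lam kap rho_x f \in L2,
    inner f (L_inv eps lam kap rho_x f) = inner f (green v) &
    weak_sol lam c eps f v].
Proof.
move=> e0 fL; have [w wL [iL iE fE]] := L_invP e0 fL.
have vL := green_L2 wL; have gL := green_L2 vL; have cgL := L2M ae_bounded_coef gL.
exists (green w) => //; split=> //; first exact: inner_aer.
move=> g g_L; have ggL := green_L2 g_L.
have s1 := L2Z eps wL; have s2 := L2Z lam vL; have s12 := L2D s1 s2.
rewrite (inner_ae fL (L2D s12 cgL) ggL fE).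
rewrite (innerDl s12 cgL ggL) (innerDl s1 s2 ggL) (innerZl _ wL ggL) (innerZl _ vL ggL).
by rewrite -(green_sym wL g_L) -(green_sym vL g_L) /form addrA.
Qed.

Let s := M ^+ 2 / (m ^+ 2 + M ^+ 2).

(** As [<f, G v> = form v v >= <c * G v, G v>], the left-hand side is at most
[2 <f, G v> - <c * G v, G v>], whose integrand is bounded pointwise by
[rho_x ^+ 2 / c * theta ^+ 2] and [rho_x ^+ 2 <= s * c] because [kap >= m ^+ 2]. *)
Lemma weak_sol_le eps theta v : 0 < eps -> theta \in L2 -> v \in L2 ->
  weak_sol lam c eps (fun x => rho_x x * theta x) v ->
  inner (fun x => rho_x x * theta x) (green v) <= s * inner theta theta.
Proof.
move=> e0 tL vL Hv; set f := fun x => _; have fL : f \in L2 := L2M ae_bounded_rho tL.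
have gL := green_L2 vL; have cgL := L2M ae_bounded_coef gL.
have h1 := form_ge c lam0 (ltW e0) vL.
rewrite -(Hv _ vL) in h1.
suff : 2 * inner f (green v) - inner (fun x => c x * green v x) (green v) <= s * inner theta theta.
  exact: twice_arith h1.
have E1 := etrans (innerBl (L2Z 2 fL) cgL gL) (congr1 (fun z => z - _) (innerZl 2 fL gL)).
rewrite -E1 -(innerZl s tL tL); apply: inner_le_ae.
- exact: (L2B (L2Z 2 fL) cgL).
- exact: gL.
- exact: (L2Z s tL).
- exact: tL.
apply: (ae_imp rM) => x /andP[mx xM]; rewrite /f.
move: (green v x) (theta x) => U T; move: mx xM; rewrite /c.
move: (rho_x x) => r mr rM'.
have r2 : r ^+ 2 <= M ^+ 2.
  by rewrite -[leLHS]real_normK ?num_real// ler_sqr ?nnegrE// (le_trans _ rM').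
have m2 : 0 < m ^+ 2 by rewrite exprn_gt0.
have mM : 0 < m ^+ 2 + M ^+ 2 by rewrite ltr_wpDr ?sqr_ge0.
have C0 : 0 < kap + r ^+ 2 by rewrite ltr_wpDr ?sqr_ge0// kap_gt0.
have sc : r ^+ 2 <= (kap + r ^+ 2) * s.
  rewrite /s mulrA ler_pdivlMr// mulrDr mulrDl.
  have h2 : r ^+ 2 * m ^+ 2 <= kap * M ^+ 2.
    by rewrite mulrC; apply: ler_pM => //; rewrite ?sqr_ge0 ?(ltW m2) ?(ltW mkap).
  by rewrite lerD2r.
exact: square_arith.
Qed.

(** The function q is nondecreasing in eps ([weak_sol_antitone]) and bounded
below, so it converges to its infimum. *)
Lemma hessian_limit theta : theta \in L2 ->
  let q (eps : R) := inner theta (theta \- B_inv eps lam kap rho_x theta) in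
  [/\ cvg (q eps @[eps --> 0^'+]),
      (1 - s) * inner theta theta <= lim (q eps @[eps --> 0^'+]) &
      lim (q eps @[eps --> 0^'+]) <= inner theta theta].
Proof.
move=> tL q; set f : R -> R := fun x => rho_x x * theta x.
have fL : f \in L2 := L2M ae_bounded_rho tL.
have qE eps : 0 < eps -> exists2 v, v \in L2 &
    q eps = inner theta theta - inner f (green v) /\ weak_sol lam c eps f v.
  move=> e0; have [v vL [iL iE Hv]] := L_inv_weak e0 fL; exists v; first exact: vL.
  split; last exact: Hv.
  have E : inner theta (fun x => rho_x x * L_inv eps lam kap rho_x f x) = inner f (green v).
    by rewrite -iE; apply: eq_inner => x; rewrite /f mulrCA mulrA.
  exact: etrans (innerBr tL (L2M ae_bounded_rho iL) tL) (congr1 (fun z => inner theta theta - z) E).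
have q_ge eps : 0 < eps -> (1 - s) * inner theta theta <= q eps.
  move=> e0; have [v vL [-> Hv]] := qE _ e0.
  by have := weak_sol_le e0 tL vL Hv; rewrite mulrBl mul1r; rewrite lerD2l lerN2.
have q_le eps : 0 < eps -> q eps <= inner theta theta.
  move=> e0; have [v vL [-> Hv]] := qE _ e0.
  by rewrite gerBl (weak_sol_ge0 lam0 coef_ge0 e0 vL Hv).
have cq : q eps @[eps --> 0^'+] --> inf (q @` `]0%R, +oo[).
  apply: nondecreasing_at_right_cvgr => //.
  - move=> e e'; rewrite !in_itv/= !andbT => e0 e'0 ee'.
    have [v vL [-> Hv]] := qE _ e0; have [v' vL' [-> Hv']] := qE _ e'0.
    by rewrite lerD2l lerN2 (weak_sol_antitone lam0 ae_bounded_coef coef_ge0 e0 ee' vL vL' Hv Hv').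
  - exists ((1 - s) * inner theta theta) => _ [e ei <-]; apply: q_ge.
    by move: ei; rewrite /= in_itv/= andbT.
have cq' := cvgP _ cq.
split => //.
- apply: limr_ge => //; near=> e; apply: q_ge; near: e; exact: nbhs_right_gt.
- apply: limr_le => //; near=> e; apply: q_le; near: e; exact: nbhs_right_gt.
Unshelve. all: by end_near. Qed.

End Inverse.
End Energy.

(** * Uniqueness from vanishing Fourier coefficients *)

Section Uniqueness.
Context {R : realType}.
Implicit Types (f g h w phi t : R -> R) (k K x y a b xi : R).
Local Notation mu := (@mu01 R).

Lemma bernoulli (u : R) n : -1 <= u -> 1 + u *+ n <= (1 + u) ^+ n.
Proof.
move=> u1; elim: n => [|n IH]; first by rewrite mulr0n addr0 expr0.
rewrite exprS mulrS; apply: (@le_trans _ _ ((1 + u) * (1 + u *+ n))); last first.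
  by rewrite ler_wpM2l//; lra.
have : 0 <= u ^+ 2 * n%:R by rewrite mulr_ge0 ?sqr_ge0.
by rewrite -(mulr_natr u n); move: (n%:R) => N; nra.
Qed.

(** By Bernoulli's inequality this tends to 1 for [0 <= x < 1/2] and to 0 for
[1/2 < x <= 1], so that polynomials in one function t approximate the indicator
function of the set where t is smaller than 1/2. *)
Definition sharpen n x : R := (1 - x ^+ n) ^+ (2 ^ n).

Lemma pfilter01 n x : 0 <= x <= 1 -> 0 <= sharpen n x <= 1.
Proof.
move=> /andP[x0 x1]; rewrite /sharpen.
have [p0 p1] : 0 <= x ^+ n /\ x ^+ n <= 1 by rewrite exprn_ge0// exprn_ile1.
by rewrite exprn_ge0 ?subr_ge0// exprn_ile1 ?subr_ge0// gerBl.
Qed.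

Lemma sharpen_cvg1 x : 0 <= x < 2^-1 -> sharpen n x @[n --> \oo] --> (1 : R).
Proof.
move=> /andP[x0 x1].
have lim : 1 - (2 * x) ^+ n @[n --> \oo] --> (1 : R).
  rewrite -[X in _ --> X]subr0; apply: cvgB; first exact: cvg_cst.
  apply: cvg_expr; rewrite ger0_norm ?mulr_ge0//.
  by move: x1; rewrite -(ltr_pM2l (ltr0n R 2)) mulfV.
apply: (@squeeze_cvgr _ _ _ _ (fun n => 1 - (2 * x) ^+ n) (fun=> 1)) => //; last exact: cvg_cst.
apply: nearW => n; have x1' : x <= 1 by apply: le_trans (ltW x1) _; rewrite invf_le1// ler1n.
have /andP[_ ->] := @pfilter01 n x (introT andP (conj x0 x1')).
rewrite andbT exprMn -natrX mulr_natl.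
have := @bernoulli (- x ^+ n) (2 ^ n); rewrite mulNrn; apply.
by rewrite lerN2 exprn_ile1.
Qed.

(** Multiply by [(1 + x ^+ n) ^+ (2 ^ n) >= (2 * x) ^+ n]: the product is at most
[(1 - x ^+ (2 * n)) ^+ (2 ^ n) <= 1]. *)
Lemma sharpen_cvg0 x : 2^-1 < x <= 1 -> sharpen n x @[n --> \oo] --> (0 : R).
Proof.
move=> /andP[x0 x1].
have xp : 0 < x by apply: lt_trans x0; rewrite invr_gt0.
have x2 : 1 < 2 * x by move: x0; rewrite -(ltr_pM2l (ltr0n R 2)) mulfV.
have x2p : 0 < 2 * x by rewrite mulr_gt0.
have lim : ((2 * x)^-1) ^+ n @[n --> \oo] --> (0 : R).
  by apply: cvg_expr; rewrite ger0_norm ?invr_ge0 ?(ltW x2p)// invf_lt1.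
apply: (@squeeze_cvgr _ _ _ _ (fun=> 0) (fun n => (2 * x)^-1 ^+ n)) => //; last exact: cvg_cst.
apply: nearW => n.
have /andP[p0 _] := @pfilter01 n x (introT andP (conj (ltW xp) x1)).
rewrite p0 /= exprVn -[leRHS]mul1r ler_pdivlMr ?exprn_gt0//.
have [q0 q1] : 0 <= x ^+ n /\ x ^+ n <= 1 by rewrite exprn_ge0 ?exprn_ile1 ?(ltW xp).
apply: (@le_trans _ _ (sharpen n x * (1 + x ^+ n) ^+ (2 ^ n))).
  rewrite ler_wpM2l// exprMn -natrX mulr_natl.
  apply: le_trans (bernoulli _ _); last by apply: le_trans q0; rewrite oppr_le0.
  by rewrite lerDr.
rewrite /sharpen -exprMn (_ : _ * _ = 1 - (x ^+ n) ^+ 2); last by ring.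
have [s0 s1] : 0 <= (x ^+ n) ^+ 2 /\ (x ^+ n) ^+ 2 <= 1.
  by rewrite sqr_ge0 exprn_ile1.
by rewrite exprn_ile1//; lra.
Qed.

Definition bounded_mbl phi := mblfun phi /\ exists K, forall x, 0 < x < 1 -> `|phi x| <= K.

Lemma bounded_mbl_L2 phi : bounded_mbl phi -> phi \in L2.
Proof. by move=> [mp [K H]]; exact: L2_bounded H. Qed.

Lemma bounded_mbl_cst k : bounded_mbl (fun=> k).
Proof. by split; [exact: mbl_cst|exists `|k|]. Qed.

Lemma bounded_mblM f g : bounded_mbl f -> bounded_mbl g -> bounded_mbl (fun x => f x * g x).
Proof.
move=> [mf [K HK]] [mg [L HL]]; split; first exact: mblM.
by exists (K * L) => x x01; rewrite normrM ler_pM ?HK ?HL.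
Qed.

Lemma bounded_mblB f g : bounded_mbl f -> bounded_mbl g -> bounded_mbl (fun x => f x - g x).
Proof.
move=> [mf [K HK]] [mg [L HL]]; split; first exact: mblB.
by exists (K + L) => x x01; rewrite (le_trans (ler_normB _ _))// lerD ?HK ?HL.
Qed.

Lemma bounded_mbl_continuous K f : continuous f -> (forall x, 0 < x < 1 -> `|f x| <= K) -> bounded_mbl f.
Proof. by move=> cf H; split; [exact: continuous_measurable_fun|exists K]. Qed.

Lemma L2_bounded_mbl f phi : f \in L2 -> bounded_mbl phi -> (fun x => f x * phi x) \in L2.
Proof.
move=> fL [mp [K H]]; rewrite (_ : (fun x => _) = fun x => phi x * f x); last first.
  by apply/funext => x; rewrite mulrC.
by apply: (@L2M _ _ K) => //; split => //; exact: ae01.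
Qed.

(** The values of t at the end points are left free, as these form a null set. *)
Definition separates t a b := [/\ bounded_mbl t, forall x, 0 < x < 1 -> 0 <= t x <= 1 &
  forall x, 0 < x < 1 -> x != a -> x != b -> (a < x < b /\ t x < 2^-1) \/ (~~ (a < x < b) /\ 2^-1 < t x)].

Lemma separates_ind_ioo f t a b : f \in L2 -> separates t a b ->
  (forall n, bounded_mbl (fun x => sharpen n (t x))) ->
  (forall n, inner f (fun x => sharpen n (t x)) = 0) -> inner f (ind_ioo a b) = 0.
Proof.
move=> fL [bt t01 ts] bp H.
have c : inner f (fun x => sharpen n (t x)) @[n --> \oo] --> inner f (ind_ioo a b).
  apply: (@bounded_cvg _ _ _ _ 1); first exact: L2_int.
  - by move=> n; exact: (bp n).1.
  - by apply: L2_mbl; exact: ind_ioo_L2.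
  - move=> n x x01; have /andP[p0 p1] := pfilter01 n (t01 x x01).
    by rewrite ger0_norm.
  - have H01 := @ae01 R (fun x => 0 < x < 1) (fun _ p => p).
    apply: (ae_imp2 H01 (ae_imp2 (ae_neq a) (ae_neq b) (fun x p q => conj p q))) => x x01 [xa xb].
    rewrite /ind_ioo; have /andP[t0 t1] := t01 x x01.
    have [[-> th]|[/negbTE-> th]] := ts x x01 xa xb.
      by apply: sharpen_cvg1; rewrite t0.
    by apply: sharpen_cvg0; rewrite th.
apply: (cvgR_unique c).
rewrite (_ : (fun n => _) = cst 0); first exact: cvg_cst.
by apply/funext => n; exact: H.
Qed.

Definition cosf xi x : R := cos (2 * pi * x * xi).
Definition sinf xi x : R := sin (2 * pi * x * xi).

Lemma cosf_continuous xi : continuous (cosf xi).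
Proof.
move=> x; apply: (@continuous_comp _ _ _ (fun x => 2 * pi * x * xi) cos); last exact: continuous_cos.
by apply: cvgM; [apply: cvgM; [exact: cvg_cst|exact: cvg_id]|exact: cvg_cst].
Qed.

Lemma sinf_continuous xi : continuous (sinf xi).
Proof.
move=> x; apply: (@continuous_comp _ _ _ (fun x => 2 * pi * x * xi) sin); last exact: continuous_sin.
by apply: cvgM; [apply: cvgM; [exact: cvg_cst|exact: cvg_id]|exact: cvg_cst].
Qed.

Lemma bounded_mbl_cosf xi : bounded_mbl (cosf xi).
Proof. by apply: (@bounded_mbl_continuous 1); [exact: cosf_continuous|move=> x _; exact: cos_max]. Qed.

Lemma bounded_mbl_sinf xi : bounded_mbl (sinf xi).
Proof. by apply: (@bounded_mbl_continuous 1); [exact: sinf_continuous|move=> x _; exact: sin_max]. Qed.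

(** The Fourier transform of [w * phi] vanishes on E, and phi is regular
enough for the products to be integrable. *)
Definition fourier_ortho (E : set R) w phi := bounded_mbl phi /\ forall xi, E xi ->
  inner w (fun x => phi x * cosf xi x) = 0 /\ inner w (fun x => phi x * sinf xi x) = 0.

Lemma fourier_orthoB E w f g : w \in L2 -> fourier_ortho E w f -> fourier_ortho E w g -> fourier_ortho E w (fun x => f x - g x).
Proof.
move=> wL [bf Hf] [bg Hg]; split; first exact: bounded_mblB.
have D (q : R -> R) : bounded_mbl q -> inner w (fun x => (f x - g x) * q x) =
    inner w (fun x => f x * q x) - inner w (fun x => g x * q x).
  move=> bq; rewrite -(innerBr (bounded_mbl_L2 (bounded_mblM bf bq)) (bounded_mbl_L2 (bounded_mblM bg bq)) wL).
  by apply: eq_inner => x; rewrite mulrBl.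
move=> xi Exi; have [f1 f2] := Hf xi Exi; have [g1 g2] := Hg xi Exi.
by rewrite (D _ (bounded_mbl_cosf xi)) (D _ (bounded_mbl_sinf xi)) f1 f2 g1 g2 subrr.
Qed.

Lemma fourier_ortho_ext E w f g : (forall x, f x = g x) -> fourier_ortho E w f -> fourier_ortho E w g.
Proof. by move=> /funext ->. Qed.

Lemma fourier_ortho_sharpen E w t phi n : w \in L2 ->
  (forall phi, fourier_ortho E w phi -> fourier_ortho E w (fun x => t x * phi x)) ->
  fourier_ortho E w phi -> fourier_ortho E w (fun x => sharpen n (t x) * phi x).
Proof.
move=> wL Ht.
have Hn (k : nat) f : fourier_ortho E w f -> fourier_ortho E w (fun x => t x ^+ k * f x).
  elim: k f => [|k IH] f Hf; first by apply: fourier_ortho_ext Hf => x; rewrite expr0 mul1r.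
  by apply: (@fourier_ortho_ext _ _ _ _ _ (Ht _ (IH _ Hf))) => x; rewrite exprS mulrA.
have H1 f : fourier_ortho E w f -> fourier_ortho E w (fun x => (1 - t x ^+ n) * f x).
  move=> Hf; apply: (@fourier_ortho_ext _ _ _ _ _ (fourier_orthoB wL Hf (Hn n f Hf))) => x.
  by rewrite mulrBl mul1r.
rewrite /sharpen; elim: (2 ^ n)%N phi => [|k IH] f Hf.
  by apply: fourier_ortho_ext Hf => x; rewrite expr0 mul1r.
by apply: (@fourier_ortho_ext _ _ _ _ _ (H1 _ (IH _ Hf))) => x; rewrite exprS mulrA.
Qed.

(** By [separates_ind_ioo], the integrals over all intervals of
[w * cos] and [w * sin] at the single frequency xi vanish.  So both products are null,
and hence also w. *)
Lemma fourier_ortho_complete (E : set R) w xi : w \in L2 -> E xi -> fourier_ortho E w (fun=> 1) ->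
  (forall a b, 0 < a -> a < b -> b < 1 -> exists2 t, separates t a b &
     forall phi, fourier_ortho E w phi -> fourier_ortho E w (fun x => t x * phi x)) ->
  w = cst 0 %[ae mu].
Proof.
move=> wL Exi H1 Ht.
have H (q : R -> R) : bounded_mbl q -> (forall phi, fourier_ortho E w phi -> inner w (fun x => phi x * q x) = 0) ->
    (fun x => w x * q x) = cst 0 %[ae mu].
  move=> bq Hq; have wqL := L2_bounded_mbl wL bq.
  apply: ind_ioo_eq0_ae => // a b a0 ab b1; have [t st tm] := Ht a b a0 ab b1.
  have o n := fourier_ortho_sharpen n wL tm H1.
  have p1 n x : sharpen n (t x) * 1 = sharpen n (t x) by rewrite mulr1.
  have o' n : fourier_ortho E w (fun x => sharpen n (t x)) := fourier_ortho_ext (p1 n) (o n).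
  apply: (separates_ind_ioo wqL st) => n; first by have [] := o' n.
  rewrite -[RHS](Hq _ (o' n)); apply: eq_inner => x; rewrite -mulrA; congr (_ * _).
  by rewrite mulrC.
have Hc := H _ (bounded_mbl_cosf xi) (fun phi o => (o.2 xi Exi).1).
have Hs := H _ (bounded_mbl_sinf xi) (fun phi o => (o.2 xi Exi).2).
apply: (ae_imp2 Hc Hs) => x /(_ I) c0 /(_ I) s0 _.
rewrite /= -[LHS]mulr1 -(cos2Dsin2 (2 * pi * x * xi)) mulrDr !expr2 !mulrA.
by move: c0 s0; rewrite /cosf /sinf /= => -> ->; rewrite !mul0r addr0.
Qed.

End Uniqueness.

(** * Completeness for integer and for large frequencies *)

Section Completeness.
Context {R : realType}.
Implicit Types (f g h w phi t : R -> R) (k l K x y a b xi eta T : R).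
Local Notation mu := (@mu01 R).

Lemma inner_lin w f g k l : w \in L2 -> f \in L2 -> g \in L2 ->
  inner w (fun x => k * f x + l * g x) = k * inner w f + l * inner w g.
Proof.
move=> wL fL gL; rewrite (innerDr (L2Z k fL) (L2Z l gL) wL).
by rewrite (innerZr k fL wL) (innerZr l gL wL).
Qed.

Lemma bounded_mbl_lin f g k l : bounded_mbl f -> bounded_mbl g -> bounded_mbl (fun x => k * f x + l * g x).
Proof.
move=> bf bg.
have := bounded_mblB (bounded_mblM (bounded_mbl_cst k) bf) (bounded_mblM (bounded_mbl_cst (- l)) bg).
rewrite (_ : (fun x => _ - _) = (fun x => k * f x + l * g x))//.
by apply/funext => x; rewrite mulNr opprK.
Qed.

Lemma fourier_ortho_lin E w f g k l : w \in L2 -> fourier_ortho E w f -> fourier_ortho E w g ->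
  fourier_ortho E w (fun x => k * f x + l * g x).
Proof.
move=> wL [bf Hf] [bg Hg]; split; first exact: bounded_mbl_lin.
have D (q : R -> R) : bounded_mbl q -> inner w (fun x => (k * f x + l * g x) * q x) =
    k * inner w (fun x => f x * q x) + l * inner w (fun x => g x * q x).
  move=> bq; rewrite -(inner_lin k l wL (bounded_mbl_L2 (bounded_mblM bf bq)) (bounded_mbl_L2 (bounded_mblM bg bq))).
  by apply: eq_inner => x; rewrite mulrDl !mulrA.
move=> xi Exi; have [f1 f2] := Hf xi Exi; have [g1 g2] := Hg xi Exi.
by rewrite (D _ (bounded_mbl_cosf xi)) (D _ (bounded_mbl_sinf xi)) f1 f2 g1 g2 !mulr0 addr0.
Qed.

Lemma cosf_cosf xi eta x : cosf xi x * cosf eta x = 2^-1 * cosf (eta + xi) x + 2^-1 * cosf (eta - xi) x.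
Proof.
by rewrite /cosf (mulrBr _ eta) (mulrDr _ eta) cosB cosD; field.
Qed.

Lemma cosf_sinf xi eta x : cosf xi x * sinf eta x = 2^-1 * sinf (eta + xi) x + 2^-1 * sinf (eta - xi) x.
Proof.
by rewrite /cosf /sinf (mulrBr _ eta) (mulrDr _ eta) sinB sinD; field.
Qed.

Lemma sinf_sinf xi eta x : sinf xi x * sinf eta x = 2^-1 * cosf (eta - xi) x + (- 2^-1) * cosf (eta + xi) x.
Proof.
by rewrite /cosf /sinf (mulrBr _ eta) (mulrDr _ eta) cosB cosD; field.
Qed.

Lemma sinf_cosf xi eta x : sinf xi x * cosf eta x = 2^-1 * sinf (eta + xi) x + (- 2^-1) * sinf (eta - xi) x.
Proof.
by rewrite /cosf /sinf (mulrBr _ eta) (mulrDr _ eta) sinB sinD; field.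
Qed.

(** Product-to-sum formulas turn a coefficient of [p * phi] into a combination of
two coefficients of phi. *)
Lemma inner_split w phi p p1 p2 q k l : w \in L2 -> bounded_mbl phi -> bounded_mbl p1 -> bounded_mbl p2 ->
  (forall x, p x * q x = k * p1 x + l * p2 x) ->
  inner w (fun x => phi x * p1 x) = 0 -> inner w (fun x => phi x * p2 x) = 0 ->
  inner w (fun x => (p x * phi x) * q x) = 0.
Proof.
move=> wL bphi b1 b2 E H1 H2.
transitivity (inner w (fun x => k * (phi x * p1 x) + l * (phi x * p2 x))).
  apply: eq_inner => x; congr (_ * _).
  by rewrite mulrAC E mulrDl -!mulrA !(mulrC (phi x)).
by rewrite (inner_lin k l wL (bounded_mbl_L2 (bounded_mblM bphi b1)) (bounded_mbl_L2 (bounded_mblM bphi b2))) H1 H2 !mulr0 addr0.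
Qed.

Section Shift.
Variables (E : set R) (w : R -> R) (xi : R).
Hypotheses (wL : w \in L2) (E1 : forall eta, E eta -> E (eta + xi) /\ E (eta - xi)).

(** Multiplication by a trigonometric function shifts the frequencies. *)
Lemma fourier_ortho_cosf phi : fourier_ortho E w phi -> fourier_ortho E w (fun x => cosf xi x * phi x).
Proof.
move=> [bp Hp]; split; first exact: bounded_mblM (bounded_mbl_cosf xi) bp.
move=> eta /E1[Ep Em]; have [p1 p2] := Hp _ Ep; have [m1 m2] := Hp _ Em; split.
- exact: (inner_split wL bp (bounded_mbl_cosf _) (bounded_mbl_cosf _) (cosf_cosf xi eta) p1 m1).
- exact: (inner_split wL bp (bounded_mbl_sinf _) (bounded_mbl_sinf _) (cosf_sinf xi eta) p2 m2).
Qed.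

Lemma fourier_ortho_sinf phi : fourier_ortho E w phi -> fourier_ortho E w (fun x => sinf xi x * phi x).
Proof.
move=> [bp Hp]; split; first exact: bounded_mblM (bounded_mbl_sinf xi) bp.
move=> eta /E1[Ep Em]; have [p1 p2] := Hp _ Ep; have [m1 m2] := Hp _ Em; split.
- exact: (inner_split wL bp (bounded_mbl_sinf _) (bounded_mbl_sinf _) (sinf_cosf xi eta) p2 m2).
- exact: (inner_split wL bp (bounded_mbl_cosf _) (bounded_mbl_cosf _) (sinf_sinf xi eta) m1 p1).
Qed.

End Shift.

(** The two sines vanish at a and b, and their product is positive exactly on
]a, b[ within ]0, 1[. *)
Definition trig_sep a b x : R := (1 - sin (pi * (x - a)) * sin (pi * (b - x))) / 2.

(** This trigonometric polynomial of degree one only involves the frequencies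
0 and 1, despite the half-integer frequencies of its two factors. *)
Lemma trig_sepE a b x : trig_sep a b x =
  (2^-1 + cos (pi * (b - a)) / 4) * 1 +
  1 * ((- cos (pi * (a + b)) / 4) * cosf 1 x + (- sin (pi * (a + b)) / 4) * sinf 1 x).
Proof.
rewrite /cosf /sinf !mulr1 mul1r.
have -> : 2 * pi * x = pi * (x - a) - pi * (b - x) + pi * (a + b) by ring.
have -> : pi * (b - a) = pi * (x - a) + pi * (b - x) by ring.
rewrite /trig_sep; move: (pi * (x - a)) (pi * (b - x)) (pi * (a + b)) => u v s.
have h : cos (u - v) = cos s * cos (u - v + s) + sin s * sin (u - v + s).
  by rewrite -cosB -cosN; congr cos; ring.
have c1 := cosB u v; have c2 := cosD u v; rewrite c2.
move: h; rewrite c1; move: (cos (u - v + s)) (sin (u - v + s)) => X Y h.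
have -> : sin u * sin v = cos s * X + sin s * Y - cos u * cos v by rewrite -h; ring.
by field.
Qed.

Lemma sin_neg x : - pi < x < 0 -> sin x < 0.
Proof.
move=> /andP[x0 x1]; rewrite -oppr_gt0 -sinN; apply: sin_gt0_pi.
by rewrite oppr_gt0 x1 ltrNl.
Qed.

Lemma trig_separates a b : 0 < a -> a < b -> b < 1 -> separates (trig_sep a b) a b.
Proof.
move=> a0 ab b1; have pi0 := pi_gt0 R; split.
- have -> : trig_sep a b = fun x => (2^-1 + cos (pi * (b - a)) / 4) * 1 +
    1 * ((- cos (pi * (a + b)) / 4) * cosf 1 x + (- sin (pi * (a + b)) / 4) * sinf 1 x).
    by apply/funext => x; exact: trig_sepE.
  apply: bounded_mbl_lin; first exact: bounded_mbl_cst.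
  by apply: bounded_mbl_lin; [exact: bounded_mbl_cosf|exact: bounded_mbl_sinf].
- move=> x _; rewrite /trig_sep.
  have : `|sin (pi * (x - a)) * sin (pi * (b - x))| <= 1.
    by rewrite normrM mulr_ile1 ?sin_max.
  by rewrite ler_norml; move: (_ * _) => z /andP[z0 z1]; apply/andP; split; lra.
- move=> x /andP[x0 x1] xa xb.
  have pos (y : R) : 0 < y < 1 -> 0 < sin (pi * y).
    move=> /andP[y0 y1]; apply: sin_gt0_pi; rewrite mulr_gt0//=.
    by rewrite gtr_pMr.
  have neg (y : R) : -1 < y < 0 -> sin (pi * y) < 0.
    move=> /andP[y0 y1]; apply: sin_neg; rewrite pmulr_rlt0// y1 andbT.
    by rewrite -mulrN1 ltr_pM2l.
  have half (z : R) : 0 < z -> (1 - z) / 2 < 2^-1 by move=> z0; lra.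
  have half' (z : R) : z < 0 -> 2^-1 < (1 - z) / 2 by move=> z0; lra.
  move: xa xb; case: (ltgtP a x) => //= ax _; case: (ltgtP x b) => //= xb _.
  + left; split=> //; apply: half; rewrite mulr_gt0// pos//; apply/andP; split; lra.
  + right; split=> //; apply: half'; rewrite pmulr_rlt0 ?neg ?pos//; apply/andP; split; lra.
  + right; split=> //; apply: half'; rewrite nmulr_rlt0 ?neg ?pos//; apply/andP; split; lra.
  + by have := lt_trans (lt_trans ax ab) xb; rewrite ltxx.
Qed.

Definition integers : set R := range (intr : int -> R).

Lemma integers_shift eta : integers eta -> integers (eta + 1) /\ integers (eta - 1).
Proof.
move=> [k _ <-]; split.
- by exists (k + 1) => //; rewrite rmorphD.
- by exists (k - 1) => //; rewrite rmorphB.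
Qed.

(** Completeness of the trigonometric system, from [fourier_ortho_complete] with
the multipliers cos and sin of frequency 1. *)
Lemma fourier_complete w : w \in L2 ->
  (forall xi, integers xi -> inner w (cosf xi) = 0 /\ inner w (sinf xi) = 0) ->
  w = cst 0 %[ae mu].
Proof.
move=> wL H.
have o1 : fourier_ortho integers w (fun=> 1).
  split; first exact: bounded_mbl_cst.
  move=> xi /H[h1 h2]; split; [rewrite -[RHS]h1|rewrite -[RHS]h2];
  by apply: eq_inner => x; rewrite mul1r.
have i0 : integers 0 by exists 0.
apply: (fourier_ortho_complete wL i0 o1) => a b a0 ab b1.
exists (trig_sep a b); first exact: trig_separates.
move=> phi op.
have oc := fourier_ortho_cosf wL integers_shift op; have os := fourier_ortho_sinf wL integers_shift op.
have o := fourier_ortho_lin (2^-1 + cos (pi * (b - a)) / 4) 1 wL op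
  (fourier_ortho_lin (- cos (pi * (a + b)) / 4) (- sin (pi * (a + b)) / 4) wL oc os).
apply: fourier_ortho_ext o => x; rewrite trig_sepE.
move: (cosf 1 x) (sinf 1 x) (phi x) (cos _) (cos _) (sin _) => *; ring.
Qed.

Lemma lipschitz1 (F dF : R -> R) u v : (forall y, is_derive y 1 F (dF y)) ->
  (forall y, `|dF y| <= 1) -> u <= v -> `|F v - F u| <= v - u.
Proof.
move=> dFP dF1 uv.
have cF : {within `[u, v], continuous F}.
  apply: continuous_subspaceT => y; apply: differentiable_continuous.
  by apply/derivable1_diffP; exact: ex_derive.
have [c _ ->] := @MVT_segment _ F dF u v uv (fun y _ => dFP y) cF.
by rewrite normrM (ger0_norm (x := v - u)) ?subr_ge0// ler_piMl ?subr_ge0.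
Qed.

(** The coefficients vanish on a half-line of frequencies, so their difference
quotients vanish there; by bounded convergence so does the derivative in the frequency,
which multiplies the integrand by x. *)
Lemma inner_diff_freq (F dF : R -> R) w phi T : (forall y, is_derive y 1 F (dF y)) ->
  (forall y, `|dF y| <= 1) -> continuous dF -> w \in L2 -> bounded_mbl phi ->
  (forall xi, T < xi -> inner w (fun x => phi x * F (2 * pi * x * xi)) = 0) ->
  forall xi, T < xi -> inner w (fun x => x * phi x * dF (2 * pi * x * xi)) = 0.
Proof.
move=> dFP dF1 cdF wL bp H xi Txi.
have cF : continuous F.
  move=> y; apply: differentiable_continuous.
  by apply/derivable1_diffP; exact: ex_derive.
have clin eta : continuous (fun x : R => 2 * pi * x * eta).
  by move=> x; apply: cvgM; [apply: cvgM; [exact: cvg_cst|exact: cvg_id]|exact: cvg_cst].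
have cFl eta : continuous (fun x : R => F (2 * pi * x * eta)).
  by move=> x; apply: continuous_comp; [exact: clin|exact: cF].
pose h n : R := n.+1%:R^-1.
have h0 n : 0 < h n by rewrite invr_gt0 ltr0n.
(* difference quotients in the frequency, with step h n *)
pose Q n x := (h n)^-1 * (F (2 * pi * x * (h n + xi)) - F (2 * pi * x * xi)).
have pi2 : 0 < 2 * pi :> R by rewrite mulr_gt0 ?pi_gt0.
have Qb n x : 0 < x < 1 -> `|Q n x| <= 2 * pi.
  move=> /andP[x0 x1]; rewrite /Q normrM gtr0_norm ?invr_gt0//.
  rewrite mulrC ler_pdivrMr//.
  have px : 2 * pi * x <= 2 * pi by rewrite ler_piMr// ltW.
  apply: (@le_trans _ _ (2 * pi * x * (h n + xi) - 2 * pi * x * xi)).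
    apply: lipschitz1 dFP dF1 _; apply: (ler_wpM2l (mulr_ge0 (ltW pi2) (ltW x0))).
    by rewrite lerDr; exact: ltW.
  by rewrite -mulrBr addrK; exact: (ler_wpM2r (ltW (h0 n)) px).
have bQ n : bounded_mbl (Q n).
  apply: (@bounded_mbl_continuous _ (2 * pi)) => [x|x]; last exact: Qb.
  by apply: cvgM; [exact: cvg_cst|apply: cvgB; exact: cFl].
have Q0 n : inner w (fun x => phi x * Q n x) = 0.
  have b eta : bounded_mbl (fun x => F (2 * pi * x * eta)).
    have [K HK] : exists K, forall x, 0 < x < 1 -> `|F (2 * pi * x * eta)| <= K.
      have c : {within `[0, 1], continuous (fun x => `|F (2 * pi * x * eta)|)}.
        by apply: continuous_subspaceT => x; apply: cvg_norm; exact: cFl.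
      have [z _ Hz] := EVT_max ler01 c; exists `|F (2 * pi * z * eta)| => x /andP[x0 x1].
      by apply: Hz; rewrite in_itv/= !ltW.
    exact: bounded_mbl_continuous HK.
  transitivity (inner w (fun x => (h n)^-1 * (phi x * F (2 * pi * x * (h n + xi))) +
      (- (h n)^-1) * (phi x * F (2 * pi * x * xi)))).
    by apply: eq_inner => x; rewrite /Q; ring.
  rewrite (inner_lin _ _ wL (bounded_mbl_L2 (bounded_mblM bp (b _))) (bounded_mbl_L2 (bounded_mblM bp (b _)))).
  by rewrite !H// ?mulr0 ?addr0//; rewrite ltr_wpDl// ltW.
have Qlim x : Q n x @[n --> \oo] --> 2 * pi * x * dF (2 * pi * x * xi).
  have D : is_derive xi 1 (fun y => F (2 * pi * x * y)) (2 * pi * x * dF (2 * pi * x * xi)).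
    have dl : is_derive xi 1 (fun y : R => 2 * pi * x * y) (2 * pi * x).
      by apply: is_derive_eq; rewrite /GRing.scale/= mulr1.
    have := @is_derive1_comp _ F (fun y : R => 2 * pi * x * y) xi _ _ (dFP _) dl.
    by move=> D; apply: is_derive_eq; rewrite mulrC.
  have := @ex_derive _ _ _ _ _ _ _ D; rewrite /derivable => c.
  have : (fun e => e^-1 *: (F (2 * pi * x * (e *: 1 + xi)) - F (2 * pi * x * xi))) @ 0^' -->
      2 * pi * x * dF (2 * pi * x * xi).
    by have E := @derive_val _ _ _ _ _ _ _ D; rewrite -[X in _ --> X]E; exact: c.
  move=> L; have hlim : (forall n, h n != 0) /\ h n @[n --> \oo] --> 0.
    by split; [move=> n; rewrite gt_eqF|exact: cvg_harmonic].
  have := (cvgr_dnbhsP _ _ _).1 L h hlim.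
  by under eq_fun do rewrite /GRing.scale/= mulr1.
have lim : inner (fun x => w x * phi x) (Q n) @[n --> \oo] -->
    inner (fun x => w x * phi x) (fun x => 2 * pi * x * dF (2 * pi * x * xi)).
  apply: (@bounded_cvg _ _ _ _ (2 * pi)).
  - exact: L2_int (L2_bounded_mbl wL bp).
  - by move=> n; exact: (bQ n).1.
  - apply: continuous_measurable_fun => x; apply: cvgM.
      by apply: cvgM; [exact: cvg_cst|exact: cvg_id].
    by apply: continuous_comp; [exact: clin|exact: cdF].
  - by move=> n x; exact: Qb.
  - by apply: ae01 => x _; exact: Qlim.
have z : inner (fun x => w x * phi x) (fun x => 2 * pi * x * dF (2 * pi * x * xi)) = 0.
  apply: (cvgR_unique lim).
  rewrite (_ : (fun n => _) = cst 0); first exact: cvg_cst.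
  by apply/funext => n; rewrite -[RHS](Q0 n); apply: eq_inner => x; rewrite mulrA.
apply: (mulfI (lt0r_neq0 pi2)); rewrite mulr0 -[RHS]z.
have bxq : bounded_mbl (fun x => x * phi x * dF (2 * pi * x * xi)).
  apply: bounded_mblM; first apply: bounded_mblM => //.
    by apply: (@bounded_mbl_continuous _ 1) => [x|x /andP[x0 x1]]; [exact: cvg_id|rewrite ger0_norm ltW].
  apply: (@bounded_mbl_continuous _ 1) => [x|x _]; last exact: dF1.
  by apply: continuous_comp; [exact: clin|exact: cdF].
rewrite -(innerZr _ (bounded_mbl_L2 bxq) wL); apply: eq_inner => x; ring.
Qed.

Definition beyond T : set R := [set xi | T < xi].

Lemma fourier_ortho_x w phi T : w \in L2 -> fourier_ortho (beyond T) w phi ->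
  fourier_ortho (beyond T) w (fun x => x * phi x).
Proof.
move=> wL [bp Hp]; split.
  apply: bounded_mblM => //; apply: (@bounded_mbl_continuous _ 1) => [x|x /andP[x0 x1]]; first exact: cvg_id.
  by rewrite ger0_norm ltW.
move=> xi Txi; split; last first.
  have := @inner_diff_freq (fun y => - cos y) sin w phi T _ _ (@continuous_sin R) wL bp _ xi Txi.
  apply => //; first by move=> y; apply: is_derive_eq; rewrite opprK.
    by move=> y; exact: sin_max.
  move=> eta /Hp[h _]; rewrite -[RHS]oppr0 -h -[RHS]mulN1r.
  rewrite -(innerZr (-1) (bounded_mbl_L2 (bounded_mblM bp (bounded_mbl_cosf eta))) wL).
  by apply: eq_inner => x; rewrite /cosf; ring.
apply: (@inner_diff_freq sin cos w phi T _ _ (@continuous_cos R) wL bp _ xi Txi).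
  by move=> y; exact: cos_max.
by move=> eta /Hp[].
Qed.

Definition quad_sep a b x : R := (1 - (x - a) * (b - x)) / 2.

Lemma quad_separates a b : 0 < a -> a < b -> b < 1 -> separates (quad_sep a b) a b.
Proof.
move=> a0 ab b1.
have q01 x : 0 < x < 1 -> 0 <= quad_sep a b x <= 1.
  move=> /andP[x0 x1]; rewrite /quad_sep.
  have : `|(x - a) * (b - x)| <= 1.
    by rewrite normrM mulr_ile1// ler_norml; apply/andP; split; lra.
  by rewrite ler_norml; move: (_ * _) => z /andP[z0 z1]; apply/andP; split; lra.
split.
- apply: (@bounded_mbl_continuous _ 1) => [x|x x01].
    apply: cvgM; last exact: cvg_cst.
    apply: cvgB; first exact: cvg_cst.
    by apply: cvgM; apply: cvgB; do ?[exact: cvg_cst|exact: cvg_id].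
  by have /andP[q0 q1] := q01 x x01; rewrite ger0_norm.
- exact: q01.
- move=> x /andP[x0 x1] xa xb.
  have half (z : R) : 0 < z -> (1 - z) / 2 < 2^-1 by move=> z0; lra.
  have half' (z : R) : z < 0 -> 2^-1 < (1 - z) / 2 by move=> z0; lra.
  move: xa xb; case: (ltgtP a x) => //= ax _; case: (ltgtP x b) => //= xb _.
  + by left; split=> //; apply: half; rewrite mulr_gt0 ?subr_gt0.
  + by right; split=> //; apply: half'; rewrite pmulr_rlt0 ?subr_lt0 ?subr_gt0.
  + by right; split=> //; apply: half'; rewrite nmulr_rlt0 ?subr_lt0 ?subr_gt0.
  + by have := lt_trans (lt_trans ax ab) xb; rewrite ltxx.
Qed.

(** A compactly supported function with band-limited Fourier transform vanishes,
from [fourier_ortho_complete] with polynomials as multipliers. *)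
Lemma bandlimited_eq0 w T : w \in L2 ->
  (forall xi, T < xi -> inner w (cosf xi) = 0 /\ inner w (sinf xi) = 0) ->
  w = cst 0 %[ae mu].
Proof.
move=> wL H.
have o1 : fourier_ortho (beyond T) w (fun=> 1).
  split; first exact: bounded_mbl_cst.
  move=> xi /H[h1 h2]; split; [rewrite -[RHS]h1|rewrite -[RHS]h2];
  by apply: eq_inner => x; rewrite mul1r.
have i0 : beyond T (T + 1) by rewrite /beyond/= ltrDl.
apply: (fourier_ortho_complete wL i0 o1) => a b a0 ab b1.
exists (quad_sep a b); first exact: quad_separates.
move=> phi op.
have ox := fourier_ortho_x wL op; have oxx := fourier_ortho_x wL ox.
have o := fourier_ortho_lin ((1 + a * b) / 2) 1 wL op (fourier_ortho_lin (- (a + b) / 2) 2^-1 wL ox oxx).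
apply: fourier_ortho_ext o => x; rewrite /quad_sep; move: (phi x) => P.
by field.
Qed.

End Completeness.

(** * Parseval's identity for trigonometric polynomials *)

Section Trig.
Context {R : realType}.
Implicit Types (f g h w phi t : R -> R) (k l K x y a b xi eta T : R).
Local Notation mu := (@mu01 R).

Lemma int01_FTC (G g : R -> R) : (forall x, is_derive x 1 G (g x)) -> continuous g ->
  \int[mu]_x g x = G 1 - G 0.
Proof.
move=> dG cg.
have cG : continuous G.
  by move=> y; apply: differentiable_continuous; apply/derivable1_diffP; exact: ex_derive.
have mg : measurable_fun setT (EFin \o g).
  by apply/measurable_EFinP; exact: continuous_measurable_fun.
have D : derivable_oo_LRcontinuous G 0 1.
  split; first by move=> x _; exact: ex_derive.
    by apply: cvg_at_right_filter; exact: cG.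
  by apply: cvg_at_left_filter; exact: cG.
rewrite /Rintegral int01E// integral_itv_bndo_bndc; last exact: measurable_funTS.
rewrite integral_itv_obnd_cbnd; last exact: measurable_funTS.
rewrite (@continuous_FTC2 _ g G) ?ltr01//.
- exact: continuous_subspaceT.
- by move=> x _; rewrite derive1E derive_val.
Qed.

Lemma integers_trig xi : integers xi -> sin (2 * pi * xi) = 0 /\ cos (2 * pi * xi) = 1.
Proof.
have H (n : nat) : sin (2 * pi * n%:R) = 0 :> R /\ cos (2 * pi * n%:R) = 1 :> R.
  have -> : 2 * pi * n%:R = 0 + (pi *+ 2) *+ n :> R.
    by rewrite add0r -(mulr_natr (pi *+ 2) n) -(mulr_natl pi 2).
  rewrite (periodicn (@sinD2pi R)) (periodicn (@cosD2pi R)).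
  by rewrite sin0 cos0.
move=> [[n|n] _ <-]; first exact: H.
rewrite NegzE mulrNz mulrN sinN cosN; have [-> ->] := H n.+1.
by rewrite oppr0.
Qed.

Lemma int_cosf xi : integers xi -> \int[mu]_x cosf xi x = (xi == 0)%:R.
Proof.
move=> Z; have [->|x0] := eqVneq xi 0.
  under eq_Rintegral do rewrite /cosf mulr0 cos0.
  exact: int_cst01.
have c0 : 2 * pi * xi != 0 by rewrite !mulf_neq0// gt_eqF// pi_gt0.
have dG x : is_derive x 1 (fun x => (2 * pi * xi)^-1 * sin (2 * pi * x * xi)) (cosf xi x).
  have dl : is_derive x 1 (fun y : R => 2 * pi * y * xi) (2 * pi * xi).
    by apply: is_derive_eq; rewrite /GRing.scale/= !(mulr0, addr0, mulr1, add0r) mulrC.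
  have D := @is_derive1_comp _ sin (fun y : R => 2 * pi * y * xi) x _ _ (is_derive_sin _) dl.
  apply: is_derive_eq; rewrite /GRing.scale/= ?(mulr0, addr0, mulr1, add0r, mul0r).
  by rewrite /cosf (mulrC (cos _)) mulKf.
rewrite (int01_FTC dG (@cosf_continuous R xi)) mulr1.
by rewrite (integers_trig Z).1 !mulr0 mul0r sin0 mulr0 subrr.
Qed.

Lemma int_sinf xi : integers xi -> \int[mu]_x sinf xi x = 0.
Proof.
move=> Z; have [->|x0] := eqVneq xi 0.
  under eq_Rintegral do rewrite /sinf mulr0 sin0.
  exact: int_cst01.
have c0 : 2 * pi * xi != 0 by rewrite !mulf_neq0// gt_eqF// pi_gt0.
have dG x : is_derive x 1 (fun x => - (2 * pi * xi)^-1 * cos (2 * pi * x * xi)) (sinf xi x).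
  have dl : is_derive x 1 (fun y : R => 2 * pi * y * xi) (2 * pi * xi).
    by apply: is_derive_eq; rewrite /GRing.scale/= !(mulr0, addr0, mulr1, add0r) mulrC.
  have D := @is_derive1_comp _ cos (fun y : R => 2 * pi * y * xi) x _ _ (is_derive_cos _) dl.
  apply: is_derive_eq; rewrite /GRing.scale/= ?(mulr0, addr0, mulr1, add0r, mul0r).
  by rewrite /sinf !mulNr mulrN opprK (mulrC (sin _)) mulKf.
rewrite (int01_FTC dG (@sinf_continuous R xi)) mulr1.
by rewrite (integers_trig Z).2 mulr0 mul0r cos0 subrr.
Qed.

Lemma integersB x y : integers x -> integers y -> integers (x - y).
Proof. by move=> [k _ <-] [l _ <-]; exists (k - l) => //; rewrite rmorphB. Qed.

Lemma integersD x y : integers x -> integers y -> integers (x + y).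
Proof. by move=> [k _ <-] [l _ <-]; exists (k + l) => //; rewrite rmorphD. Qed.

Lemma int_lin f g k l : f \in L2 -> g \in L2 ->
  \int[mu]_x (k * f x + l * g x) = k * \int[mu]_x f x + l * \int[mu]_x g x.
Proof.
move=> fL gL; rewrite RintegralD//; [|exact: L2_int (L2Z k fL)|exact: L2_int (L2Z l gL)].
by rewrite RintegralZl ?RintegralZl//; exact: L2_int.
Qed.

Let bc xi : cosf xi \in L2 := bounded_mbl_L2 (bounded_mbl_cosf xi).
Let bs xi : sinf xi \in L2 := bounded_mbl_L2 (bounded_mbl_sinf xi).

Lemma inner_cosf_cosf xi eta : integers xi -> integers eta ->
  inner (cosf xi) (cosf eta) = 2^-1 * (eta + xi == 0)%:R + 2^-1 * (eta - xi == 0)%:R.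
Proof.
move=> Z Z'; rewrite innerE; under eq_Rintegral do rewrite cosf_cosf.
by rewrite int_lin ?int_cosf//; [exact: integersB|exact: integersD].
Qed.

Lemma inner_sinf_sinf xi eta : integers xi -> integers eta ->
  inner (sinf xi) (sinf eta) = 2^-1 * (eta - xi == 0)%:R - 2^-1 * (eta + xi == 0)%:R.
Proof.
move=> Z Z'; rewrite innerE; under eq_Rintegral do rewrite sinf_sinf.
by rewrite int_lin ?int_cosf ?mulNr//; [exact: integersD|exact: integersB].
Qed.

Lemma inner_cosf_sinf xi eta : integers xi -> integers eta ->
  inner (cosf xi) (sinf eta) = 0.
Proof.
move=> Z Z'; rewrite innerE; under eq_Rintegral do rewrite cosf_sinf.
by rewrite int_lin ?int_sinf ?mulr0 ?addr0//; [exact: integersB|exact: integersD].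
Qed.

(** For [i < (2 * N).+1] these are the integers from -N to N. *)
Definition mode_freq (N i : nat) : R := i%:R - N%:R.

Lemma integers_mode_freq N i : integers (mode_freq N i).
Proof. by exists (i%:Z - N%:Z) => //; rewrite rmorphB. Qed.

Lemma mode_freq_inj N : injective (mode_freq N).
Proof. by move=> i j /addIr /eqP; rewrite eqr_nat => /eqP. Qed.

Lemma mode_freq_surj N xi : integers xi -> `|xi| <= N%:R -> exists2 i, (i < (2 * N).+1)%N & xi = mode_freq N i.
Proof.
move=> [k _ <-] kN.
have kN' : `|k| <= N%:Z by rewrite -(ler_int R) intr_norm.
exists (absz (k + N%:Z)%R); first by lia.
rewrite /mode_freq natr_absz.
rewrite ger0_norm; last by lia.
by rewrite rmorphD/= addrK.
Qed.

(** Stated without the condition that xi belongs to the range of summation: beyond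
it both sides vanish. *)
Lemma sum_delta N (G : R -> R) xi : integers xi -> (N%:R < `|xi| -> G xi = 0) ->
  \sum_(i < (2 * N).+1) G (mode_freq N i) * (mode_freq N i == xi)%:R = G xi.
Proof.
move=> Z GN; have [xN|xN] := leP `|xi| N%:R; last first.
  rewrite GN// big1// => i _; have [->|] := eqVneq (mode_freq N i) xi; last by rewrite mulr0.
  by rewrite GN// mul0r.
have [i0 i0N xiE] := mode_freq_surj Z xN.
rewrite (bigD1 (Ordinal i0N))//= -xiE eqxx mulr1 big1 ?addr0// => i ii0.
rewrite xiE (inj_eq (@mode_freq_inj N)); case: eqP => [e|]; last by rewrite mulr0.
by move: ii0; rewrite -val_eqE/= e eqxx.
Qed.

End Trig.

Section Parseval.
Context {R : realType}.
Implicit Types (f g h w phi t : R -> R) (k l K x y a b xi eta T : R).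
Local Notation mu := (@mu01 R).

Let bc xi : cosf xi \in L2 := bounded_mbl_L2 (bounded_mbl_cosf xi).
Let bs xi : sinf xi \in L2 := bounded_mbl_L2 (bounded_mbl_sinf xi).

Lemma sum_L2 (f : nat -> R -> R) n : (forall i, f i \in L2) ->
  (fun x => \sum_(i < n) f i x) \in L2.
Proof.
move=> fL; elim: n => [|n IH].
  rewrite (_ : (fun x => _) = fun=> 0); first exact: L2_cst.
  by apply/funext => x; rewrite big_ord0.
rewrite (_ : (fun x => _) = fun x => \sum_(i < n) f i x + f n x); first exact: L2D.
by apply/funext => x; rewrite big_ord_recr.
Qed.

Lemma inner_sum w (f : nat -> R -> R) n : w \in L2 -> (forall i, f i \in L2) ->
  inner w (fun x => \sum_(i < n) f i x) = \sum_(i < n) inner w (f i).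
Proof.
move=> wL fL; elim: n => [|n IH].
  transitivity (inner w (fun=> 0)); first by apply: eq_inner => x; rewrite big_ord0.
  by rewrite (inner_cst 0 wL) mul0r big_ord0.
rewrite big_ord_recr/= -IH -(innerDr (sum_L2 n fL) (fL n) wL).
by apply: eq_inner => x; rewrite big_ord_recr.
Qed.

Lemma cosfN xi : cosf (- xi) = cosf xi.
Proof. by apply/funext => x; rewrite /cosf mulrN cosN. Qed.

Lemma sinfN xi : sinf (- xi) = fun x => - sinf xi x.
Proof. by apply/funext => x; rewrite /sinf mulrN sinN. Qed.

Section Coefs.
Variables (w : R -> R) (N : nat).
Hypotheses (wL : w \in L2) (wN : forall xi, integers xi -> N%:R < `|xi| ->
  inner w (cosf xi) = 0 /\ inner w (sinf xi) = 0).

Let A xi := inner w (cosf xi).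
Let B xi := inner w (sinf xi).

Let mode (i : nat) x := A (mode_freq N i) * cosf (mode_freq N i) x + B (mode_freq N i) * sinf (mode_freq N i) x.

Let mode_L2 i : mode i \in L2.
Proof. exact: L2D (L2Z _ (bc _)) (L2Z _ (bs _)). Qed.

Let AN xi : A (- xi) = A xi.
Proof. by rewrite /A cosfN. Qed.

Let BN xi : B (- xi) = - B xi.
Proof.
rewrite /B sinfN -mulN1r -(innerZr (-1) (bs xi) wL).
by apply: eq_inner => x; rewrite mulN1r.
Qed.

Lemma inner_mode_cosf i xi : integers xi ->
  inner (cosf xi) (mode i) = 2^-1 * (A (mode_freq N i) * (mode_freq N i == xi)%:R) +
    2^-1 * (A (mode_freq N i) * (mode_freq N i == - xi)%:R).
Proof.
move=> Z; have Zi := @integers_mode_freq R N i.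
rewrite (inner_lin _ _ (bc xi) (bc _) (bs _)).
rewrite (inner_cosf_sinf Z Zi) mulr0 addr0 (inner_cosf_cosf Z Zi) addr_eq0 subr_eq0.
by rewrite mulrDr addrC !(mulrCA _ 2^-1).
Qed.

Lemma inner_mode_sinf i xi : integers xi ->
  inner (sinf xi) (mode i) = 2^-1 * (B (mode_freq N i) * (mode_freq N i == xi)%:R) -
    2^-1 * (B (mode_freq N i) * (mode_freq N i == - xi)%:R).
Proof.
move=> Z; have Zi := @integers_mode_freq R N i.
rewrite (inner_lin _ _ (bs xi) (bc _) (bs _)).
rewrite (innerC (sinf xi)) (inner_cosf_sinf Zi Z) mulr0 add0r (inner_sinf_sinf Z Zi) subr_eq0 addr_eq0.
by rewrite mulrBr !(mulrCA _ 2^-1).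
Qed.

Lemma integersN xi : integers xi -> integers (- xi).
Proof. by move=> Z; rewrite -sub0r; apply: integersB => //; exists 0. Qed.

(** The difference of both sides has no Fourier coefficient at any integer, hence
is null.  The sum runs over positive and negative frequencies, so each mode occurs
twice; this makes up for the factor 1/2 in the orthogonality relations.  The constant
mode occurs once and has norm 1. *)
Lemma expansion_ae : w = (fun x => \sum_(i < (2 * N).+1) mode i x) %[ae mu].
Proof.
set S : R -> R := fun x => _; have SL : S \in L2 := sum_L2 _ mode_L2.
have : (fun x => w x - S x) = cst 0 %[ae mu].
  apply: fourier_complete; first exact: L2B.
  move=> xi Z; have ZN := integersN Z.
  have A0 : N%:R < `|xi| -> A xi = 0 by move=> /(wN Z)[].
  have B0 : N%:R < `|xi| -> B xi = 0 by move=> /(wN Z)[].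
  have A0' : N%:R < `|- xi| -> A (- xi) = 0 by rewrite normrN AN.
  have B0' : N%:R < `|- xi| -> B (- xi) = 0 by rewrite normrN BN => /B0 ->; rewrite oppr0.
  rewrite (innerBl wL SL (bc xi)) (innerBl wL SL (bs xi)) (innerC S) (innerC S).
  rewrite (inner_sum _ (bc xi) mode_L2) (inner_sum _ (bs xi) mode_L2).
  rewrite (eq_bigr _ (fun (i : 'I__) _ => inner_mode_cosf i Z)).
  rewrite (eq_bigr _ (fun (i : 'I__) _ => inner_mode_sinf i Z)).
  rewrite big_split sumrB -!mulr_sumr !sum_delta// AN BN -/(A xi) -/(B xi).
  by split; rewrite /=; field.
by move=> e; apply: (ae_imp e) => x /(_ I) /eqP; rewrite subr_eq0 => /eqP.
Qed.

Lemma parseval : inner w w = \sum_(i < (2 * N).+1) (A (mode_freq N i) ^+ 2 + B (mode_freq N i) ^+ 2).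
Proof.
rewrite (inner_aer wL (sum_L2 (2 * N).+1 mode_L2) wL expansion_ae).
rewrite (inner_sum _ wL mode_L2); apply: eq_bigr => i _.
by rewrite (inner_lin _ _ wL (bc _) (bs _)) !expr2.
Qed.

End Coefs.

(** The transform is Lipschitz continuous in the frequency, hence measurable. *)
Lemma fourier_lipschitz (F dF : R -> R) w : (forall y, is_derive y 1 F (dF y)) ->
  (forall y, `|dF y| <= 1) -> w \in L2 ->
  (forall xi, bounded_mbl (fun x => F (2 * pi * x * xi))) ->
  mblfun (fun xi => inner w (fun x => F (2 * pi * x * xi))).
Proof.
move=> dFP dF1 wL b; apply: continuous_measurable_fun => xi.
have pi2 : 0 < 2 * pi :> R by rewrite mulr_gt0 ?pi_gt0.
have lip eta : `|inner w (fun x => F (2 * pi * x * xi)) - inner w (fun x => F (2 * pi * x * eta))|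
    <= (norm2 w * (2 * pi)) * `|xi - eta|.
  rewrite -(innerBr (bounded_mbl_L2 (b xi)) (bounded_mbl_L2 (b eta)) wL).
  have bb := bounded_mblB (b xi) (b eta).
  apply: le_trans (cauchy_schwarz wL (bounded_mbl_L2 bb)) _.
  rewrite -mulrA; apply: ler_wpM2l; first exact: norm2_ge0.
  apply: norm2_bounded; [exact: bb.1|by rewrite mulr_ge0// ltW|].
  move=> x /andP[x0 x1].
  have l u v : `|F u - F v| <= `|u - v|.
    have [uv|/ltW uv] := leP u v.
      by rewrite distrC (distrC u) (ger0_norm (x := v - u)) ?subr_ge0//; exact: lipschitz1 dFP dF1 uv.
    by rewrite (ger0_norm (x := u - v)) ?subr_ge0//; exact: lipschitz1 dFP dF1 uv.
  apply: le_trans (l _ _) _; rewrite -mulrBr normrM ler_wpM2r// normrM.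
  by rewrite (gtr0_norm pi2) (gtr0_norm x0) ler_piMr// ltW.
apply/cvgrPdist_le => e e0.
set L := norm2 w * (2 * pi) in lip.
have L0 : 0 <= L by rewrite mulr_ge0 ?norm2_ge0// ltW.
have d0 : 0 < e / (L + 1) by rewrite divr_gt0// ltr_wpDl.
near=> eta; apply: le_trans (lip eta) _.
apply: (@le_trans _ _ ((L + 1) * `|xi - eta|)); first by rewrite ler_wpM2r// lerDl.
rewrite mulrC -ler_pdivlMr; last by rewrite ltr_wpDl.
near: eta; exact: (@cvgr_dist_le _ _ _ _ _ id xi (@cvg_id _ (nbhs xi)) _ d0).
Unshelve. all: by end_near. Qed.

End Parseval.

(** * The negative Sobolev norm *)

Section NegativeNorm.
Context {R : realType}.
Implicit Types (f g h w phi t : R -> R) (k l K x y a b xi eta T : R).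
Local Notation mu := (@mu01 R).

(** The squared modulus of the Fourier transform. *)
Definition spectrum w xi : R := inner w (cosf xi) ^+ 2 + inner w (sinf xi) ^+ 2.

Lemma spectrum_ge0 w xi : 0 <= spectrum w xi.
Proof. by rewrite addr_ge0 ?sqr_ge0. Qed.

Lemma fourierE w xi : fourier w xi = Complex (inner w (cosf xi)) (- inner w (sinf xi)).
Proof. by rewrite !innerE. Qed.

Lemma spectrum_mbl w : w \in L2 -> mblfun (spectrum w).
Proof.
move=> wL.
have mc : mblfun (fun xi => inner w (cosf xi)).
  apply: (@fourier_lipschitz _ _ (fun x => - sin x)) => // [y|xi].
    by rewrite normrN sin_max.
  exact: bounded_mbl_cosf.
have ms : mblfun (fun xi => inner w (sinf xi)).
  apply: (@fourier_lipschitz _ _ cos) => // [y|xi].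
    by rewrite cos_max.
  exact: bounded_mbl_sinf.
rewrite /spectrum; under eq_fun do rewrite !expr2.
by apply: mblD; apply: mblM.
Qed.

Lemma weight_gt0 xi : 0 < 1 + xi ^+ 2.
Proof. by rewrite ltr_wpDr ?sqr_ge0. Qed.

Definition wspectrum w xi : R := (1 + xi ^+ 2)^-1 * spectrum w xi.

Lemma wspectrum_ge0 w xi : 0 <= wspectrum w xi.
Proof. by rewrite mulr_ge0 ?spectrum_ge0// invr_ge0 ltW ?weight_gt0. Qed.

Lemma wspectrum_mbl w : w \in L2 -> mblfun (wspectrum w).
Proof.
move=> wL; apply: mblM; last exact: spectrum_mbl.
apply: continuous_measurable_fun => xi; apply: cvgV; first by rewrite gt_eqF ?weight_gt0.
by apply: cvgD; [exact: cvg_cst|exact: exprn_continuous].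
Qed.

Lemma Hm1_integrand w xi :
  (`|((1 + `|xi| ^+ 2) `^ (- 2^-1) * normc (fourier w xi))%:E| `^ (2%R : R) = (wspectrum w xi)%:E)%E.
Proof.
rewrite fourierE /= sqrrN -/(spectrum w xi) real_normK ?num_real//.
rewrite powR_mulrn//; congr EFin.
rewrite real_normK ?num_real// exprMn sqr_sqrtr ?spectrum_ge0// /wspectrum.
congr (_ * _); rewrite powRN powR12_sqrt ?exprVn ?sqr_sqrtr//; exact: ltW (weight_gt0 _).
Qed.

(** The value of the integral is required to be finite since [Hm1_norm] is the real
part of an extended real number. *)
Lemma Hm1_sqr F w (S : R) : 0 <= S ->
  (\int[freq_measure F]_xi (wspectrum w xi)%:E = S%:E)%E -> Hm1_norm F w ^+ 2 = S.
Proof.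
move=> S0 e; rewrite /Hm1_norm Lnorm.unlock.
under eq_fun do rewrite Hm1_integrand.
by rewrite e poweR_EFin /= powR12_sqrt// sqr_sqrtr.
Qed.

(** The complement of the integers is null for the restricted counting measure,
and on the integers h is a finite combination of indicator functions of points. *)
Lemma integral_integers N h : mblfun h -> (forall xi, 0 <= h xi) ->
  (forall xi, integers xi -> N%:R < `|xi| -> h xi = 0) ->
  (\int[freq_measure Periodic]_xi (h xi)%:E = (\sum_(i < (2 * N).+1) h (mode_freq N i))%:E)%E.
Proof.
move=> mh h0 hN.
pose s (i : nat) xi : R := \1_[set mode_freq N i] xi.
have ms i : mblfun (s i) by exact: measurable_indic.
have msE i : measurable_fun setT (EFin \o s i) by apply/measurable_EFinP; exact: ms.
have m1 (i : 'I_(2 * N).+1) : measurable_fun setT (fun xi => (h (mode_freq N i))%:E * (s i xi)%:E)%E.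
  by apply/measurable_EFinP; apply: mblM => //; exact: mbl_cst.
have e : ae_eq (freq_measure Periodic) setT (EFin \o h)
    (fun xi => \sum_(i < (2 * N).+1) (h (mode_freq N i))%:E * (s i xi)%:E)%E.
  exists (~` range (intr : int -> R)); split.
  - by apply: measurableC; exact: measurable_range_intr.
  - suff : counting (~` range (intr : int -> R) `&` range (intr : int -> R)) = 0 :> \bar R by [].
    by rewrite setICl measure0.
  move=> xi /= nh Z; apply: nh => _ /=.
  under eq_bigr do rewrite -EFinM.
  rewrite sumEFin; congr EFin; rewrite -(sum_delta Z (hN xi Z)).
  apply: eq_bigr => i _; rewrite /s indicE; congr (_ * (nat_of_bool _)%:R).
  by apply/eqP/idP => [->|/set_mem ->//]; rewrite inE.
rewrite (ae_eq_integral _ _ _ _ _ e) //; last 2 first.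
- by apply/measurable_EFinP.
- by apply: emeasurable_sum => i; exact: m1.
rewrite ge0_integral_sum//; last first.
  by move=> i xi _; rewrite mule_ge0 ?lee_fin ?h0.
rewrite -sumEFin; apply: eq_bigr => i _.
rewrite ge0_integralZl; [|by []|exact: msE|by move=> xi _; rewrite lee_fin|by rewrite lee_fin].
rewrite integral_indic// setIT.
have -> : freq_measure Periodic ([set mode_freq N i] : set R) = counting ([set mode_freq N i] : set R) :> \bar R.
  transitivity (counting ([set mode_freq N i] `&` range (intr : int -> R)) : \bar R) => //.
  by rewrite setIidl// => xi ->; exact: integers_mode_freq.
rewrite /counting asboolT; last exact: finite_set1.
by rewrite fset_set1 finmap.cardfs1 mule1.
Qed.
End NegativeNorm.

(** * Comparison of the norms and conclusion *)

Section Comparison.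
Context {R : realType}.
Implicit Types (f g h w phi t : R -> R) (k l K x y a b xi eta T : R).
Local Notation mu := (@mu01 R).

Lemma spectrum_eq0 w xi : fourier w xi = 0 <-> inner w (cosf xi) = 0 /\ inner w (sinf xi) = 0.
Proof.
rewrite fourierE; split=> [[-> /eqP]|[-> ->]]; last by rewrite oppr0.
by rewrite oppr_eq0 => /eqP.
Qed.

Lemma wspectrum_eq0 w xi : inner w (cosf xi) = 0 /\ inner w (sinf xi) = 0 -> wspectrum w xi = 0.
Proof. by move=> [a0 b0]; rewrite /wspectrum /spectrum a0 b0 !expr0n addr0 mulr0. Qed.

(** The support is a closure, so it contains every frequency with a nonzero
coefficient. *)
Lemma supp_fourier_eq0 F w T xi : supp_fourier F w `<=` `[- T, T] ->
  freq F xi -> T < `|xi| -> inner w (cosf xi) = 0 /\ inner w (sinf xi) = 0.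
Proof.
move=> sT Fxi Txi; apply/spectrum_eq0/eqP/negP => /negP xi0.
have /sT : supp_fourier F w xi by apply: subset_closure.
by rewrite /= in_itv/= -ler_norml leNgt Txi.
Qed.

Lemma Hm1_equiv_RealLine w T : w \in L2 -> supp_fourier RealLine w `<=` `[- T, T] ->
  inner w w = 0 /\ Hm1_norm RealLine w ^+ 2 = 0.
Proof.
move=> wL sT.
have w0 : w = cst 0 %[ae mu].
  apply: (@bandlimited_eq0 _ _ T wL) => xi Txi; apply: (supp_fourier_eq0 sT) => //.
  by rewrite (lt_le_trans Txi)// ler_norm.
have z g : g \in L2 -> inner w g = 0.
  move=> gL; rewrite (inner_ae wL (L2_cst 0) gL w0).
  transitivity (0 * inner g g); last by rewrite mul0r.
  by rewrite -(innerZl 0 gL gL); apply: eq_inner => x; rewrite /= !mul0r.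
split; first exact: z.
apply: Hm1_sqr => //; rewrite -[RHS](@integral0 _ _ _ (freq_measure RealLine) setT).
congr integral; apply/funext => xi.
by rewrite wspectrum_eq0//; split; apply: z; apply: bounded_mbl_L2; [exact: bounded_mbl_cosf|exact: bounded_mbl_sinf].
Qed.

Lemma Hm1_equiv_Periodic w T : 0 < T -> w \in L2 -> supp_fourier Periodic w `<=` `[- T, T] ->
  Hm1_norm Periodic w ^+ 2 <= inner w w <= (1 + T ^+ 2) * Hm1_norm Periodic w ^+ 2.
Proof.
move=> T0 wL sT; set N := (Num.trunc T).+1.
have TN : T < N%:R by exact: truncnS_gt.
have c0 xi : integers xi -> T < `|xi| -> inner w (cosf xi) = 0 /\ inner w (sinf xi) = 0.
  exact: supp_fourier_eq0 sT.
have c0N xi : integers xi -> N%:R < `|xi| -> inner w (cosf xi) = 0 /\ inner w (sinf xi) = 0.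
  by move=> Z /(lt_trans TN); exact: c0.
rewrite (parseval wL c0N).
rewrite (@Hm1_sqr _ _ _ (\sum_(i < (2 * N).+1) wspectrum w (mode_freq N i))); last 2 first.
- by apply: sumr_ge0 => i _; exact: wspectrum_ge0.
- apply: integral_integers; [exact: wspectrum_mbl|exact: wspectrum_ge0|].
  by move=> xi Z /(c0N _ Z); exact: wspectrum_eq0.
apply/andP; split.
  apply: ler_sum => i _; apply: ler_piMl; first exact: spectrum_ge0.
  by rewrite invf_le1 ?weight_gt0// lerDl sqr_ge0.
rewrite mulr_sumr; apply: ler_sum => i _; rewrite /wspectrum mulrA -/(spectrum w (mode_freq N i)).
have [iT|Ti] := leP `|mode_freq N i| T; last first.
  have [a0 b0] := c0 _ (integers_mode_freq N i) Ti.
  by rewrite /spectrum a0 b0 !expr0n addr0 mulr0.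
apply: ler_peMl; first exact: spectrum_ge0.
rewrite ler_pdivlMr ?weight_gt0// mul1r lerD2l -[leLHS]real_normK ?num_real//.
by rewrite lerXn2r ?nnegrE// ltW.
Qed.

(** On the line both norms vanish; on a period the weight [(1 + n ^+ 2)^-1] lies
between [(1 + T ^+ 2)^-1] and 1 at every frequency n that occurs. *)
Lemma Hm1_equiv F w T : 0 < T -> w \in L2 -> supp_fourier F w `<=` `[- T, T] ->
  Hm1_norm F w ^+ 2 <= inner w w <= (1 + T ^+ 2) * Hm1_norm F w ^+ 2.
Proof.
case: F => T0 wL sT; last exact: Hm1_equiv_Periodic.
by have [-> ->] := Hm1_equiv_RealLine wL sT; rewrite mulr0 lexx.
Qed.

End Comparison.

Theorem corollary4p1 (R : realType) (F : fourier_setting) (T : R) (T_gt0 : 0 < T) :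
  exists kap0 lam0 : R, [/\ 0 < kap0, 0 < lam0 &
    forall (m M : R) (rho rho_x : R -> R),
      0 < m ->
      (forall x : R, x \in `]0, 1[ -> is_derive x 1 rho (rho_x x)) ->
      Hsob 2 rho_x ->
      {ae mu01, forall x, m <= `|rho_x x| <= M} ->
      exists C1 C2 : R, [/\ 0 < C1, 0 < C2 &
        forall theta : R -> R, theta \in L2 ->
          supp_fourier F theta `<=` `[- T, T] ->
          forall kap lam : R, m ^+ 2 < kap < kap0 -> 0 <= lam <= lam0 ->
          let q (eps : R) := inner theta (theta \- B_inv eps lam kap rho_x theta) in
          [/\ cvg (q eps @[eps --> 0^'+]),
              C1 * Hm1_norm F theta ^+ 2 <= lim (q eps @[eps --> 0^'+]) &
              lim (q eps @[eps --> 0^'+]) <= C2 * Hm1_norm F theta ^+ 2]]].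
Proof.
exists 1, 1; split => // m M rho rho_x m0 _ [rL _] mM.
have d0 : 0 < m ^+ 2 + M ^+ 2 by rewrite ltr_wpDr ?sqr_ge0 ?exprn_gt0.
have C0 : 0 < 1 - M ^+ 2 / (m ^+ 2 + M ^+ 2).
  by rewrite subr_gt0 ltr_pdivrMr// mul1r ltrDr exprn_gt0.
exists (1 - M ^+ 2 / (m ^+ 2 + M ^+ 2)), (1 + T ^+ 2).
split=> [//||theta thL sT kap lam /andP[mk _] /andP[lam0 _] q].
  by rewrite ltr_wpDr ?sqr_ge0.
have [cq lo up] := hessian_limit lam0 m0 mk rL mM thL.
have /andP[h1 h2] := Hm1_equiv T_gt0 thL sT.
split=> //; last exact: le_trans up h2.
by apply: le_trans lo; apply: ler_wpM2l h1; exact: ltW.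
Qed.
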